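(* Let $\Omega\subset\mathbb{R}^n$ be a bounded domain satisfying the uniform exterior cone condition and let $p\in[2,\infty)$. Suppose that $\rho\in C(\overline\Omega)$ is a continuous admissible radius function in $\Omega$ satisfying $$\lambda\,\mathrm{dist}(x,\partial\Omega)^\beta\le\rho(x)\le\Lambda\,\mathrm{dist}(x,\partial\Omega)$$ for all $x\in\Omega$, where $$\beta\ge 1,\qquad 0<\Lambda<1-\left(\frac{p-2}{n+p}\right)^{1/\beta},\qquad 0<\lambda\le\Lambda\left(\frac{\mathrm{diam}\,\Omega}{2}\right)^{1-\beta}.$$ Then for any $f\in C(\partial\Omega)$ there exists a unique solution $u_\rho\in C(\overline\Omega)$ to the Dirichlet problem $$\mathcal{T}_{\rho,p}u_\rho=u_\rho\ \text{ in }\Omega,\qquad u_\rho=f\ \text{ on }\partial\Omega.$$ Furthermore, for any norm-preserving continuous extension $u\in C(\overline\Omega)$ of $f$, the sequence of iterates $\{\mathcal{T}_{\rho,p}^k u\}_k$ converges uniformly to $u_\rho$ in $\overline\Omega$.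
   Context: Uniform exterior cone condition: for $\alpha\in(0,\frac{\pi}{2})$ and $r>0$ let $K_{\alpha,r}=\{x\in\mathbb{R}^n: x_1\le-|x|\cos\alpha\text{ and }|x|\le r\}$. A domain $\Omega\subset\mathbb{R}^n$ satisfies the uniform exterior cone condition if there exist constants $\alpha\in(0,\frac{\pi}{2})$ and $r>0$ such that for every $\xi\in\partial\Omega$ there is a rotation $R\in SO(n)$ with $\xi+R(K_{\alpha,r})\subset\mathbb{R}^n\setminus\Omega$. Admissible radius function: a function $\rho:\overline\Omega\to[0,\infty)$ with $0<\rho(x)\le\mathrm{dist}(x,\partial\Omega)$ for every $x\in\Omega$, and $\rho(x)=0$ if and only if $x\in\partial\Omega$. Write $B_\rho(x)=B(x,\rho(x))$ for the ball of center $x$ and radius $\rho(x)$. Operators: for $u\in C(\overline\Omega)$ put, for $x\in\Omega$, $\mathcal{S}_\rho u(x)=\frac12\sup_{B_\rho(x)}u+\frac12\inf_{B_\rho(x)}u$ and $\mathcal{M}_\rho u(x)=\frac{1}{|B_\rho(x)|}\int_{B_\rho(x)}u(y)\,dy$, and for $x\in\partial\Omega$, $\mathcal{S}_\rho u(x)=\mathcal{M}_\rho u(x)=u(x)$. For $p\in[2,\infty)$, $$\mathcal{T}_{\rho,p}=\frac{p-2}{n+p}\,\mathcal{S}_\rho+\frac{n+2}{n+p}\,\mathcal{M}_\rho .$$ $\mathcal{T}_{\rho,p}^k$ denotes the $k$-th iterate. (For $\rho$ continuous, $\mathcal{T}_{\rho,p}$ maps $C(\overline\Omega)$ into $C(\overline\Omega)$.)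 A norm-preserving continuous extension of $f\in C(\partial\Omega)$ is a function $u\in C(\overline\Omega)$ with $u|_{\partial\Omega}=f$ and $\|u\|_{\infty,\Omega}=\|f\|_{\infty,\partial\Omega}$. *)

(* Defs.v *)
From HB Require Import structures.
From mathcomp Require Import all_boot all_order all_algebra.
From mathcomp Require Import all_classical all_reals all_analysis.
Set Implicit Arguments.
Unset Strict Implicit.
Unset Printing Implicit Defensive.
Import Order.TTheory GRing.Theory Num.Theory.
Import numFieldNormedType.Exports.
Local Open Scope classical_set_scope.
Local Open Scope ring_scope.

(* R^n is 'rV[R]_n.  The library norm on this type is the sup norm; it induces
   the usual topology and the usual bounded sets, but balls, distances and
   diameters are taken with respect to the Euclidean norm below. *)
Section euclidean_space.
Context {R : realType} {n : nat}.
Implicit Types (x y : 'rV[R]_n) (A : set 'rV[R]_n).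

Definition eucl_norm x : R := Num.sqrt (\sum_i x 0 i ^+ 2).

Definition eucl_ball x (r : R) : set 'rV[R]_n :=
  [set y | eucl_norm (y - x) < r].

Definition boundary A : set 'rV[R]_n := closure A `\` interior A.

Definition dist_to A x : R := inf [set eucl_norm (x - y) | y in A].

Definition diam A : R := sup [set eucl_norm (x - y) | x in A & y in A].

Definition sup_norm A (u : 'rV[R]_n -> R) : R := sup [set `|u x| | x in A].

Definition domain A : Prop := [/\ open A, connected A & A !=set0].

End euclidean_space.

Section exterior_cone.
Context {R : realType} {n : nat}.

(* 'rV[R]_n.+1 is used so that there is a first coordinate x 0 0. *)
Definition cone (alpha r : R) : set 'rV[R]_n.+1 :=
  [set x : 'rV[R]_n.+1 |
    x 0 0 <= - (eucl_norm x * cos alpha) /\ eucl_norm x <= r].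

(* Vectors are rows, hence a rotation acts by multiplication on the right. *)
Definition rotation (Q : 'M[R]_n.+1) : Prop := Q *m Q^T = 1%:M /\ \det Q = 1.

Definition uniform_exterior_cone (Omega : set 'rV[R]_n.+1) : Prop :=
  exists alpha r : R, [/\ 0 < alpha, alpha < pi / 2, 0 < r &
    forall xi, boundary Omega xi ->
      exists2 Q, rotation Q &
        [set xi + x *m Q | x in cone alpha r] `<=` ~` Omega].

End exterior_cone.

Section cons_measure.
Local Open Scope ereal_scope.
Context {R : realType} {n : nat} {d : measure_display} {T : measurableType d}.
Variable m1 : {sigma_finite_measure set T -> \bar R}.
Variable m2 : {sigma_finite_measure set (n.-tuple T) -> \bar R}.

Let cons_pair (z : T * n.-tuple T) : n.+1.-tuple T := [tuple of z.1 :: z.2].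

Let measurable_cons_pair : measurable_fun setT cons_pair.
Proof. exact: measurable_cons. Qed.

(* The product of m1 and m2, transported along the bijection
   T * n.-tuple T -> n.+1.-tuple T. *)
Definition cons_measure : set (n.+1.-tuple T) -> \bar R :=
  pushforward (m1 \x m2) cons_pair.

Let cons_measure0 : cons_measure set0 = 0.
Proof. by rewrite /cons_measure /pushforward preimage_set0 measure0. Qed.

Let cons_measure_ge0 A : 0 <= cons_measure A.
Proof. exact: measure_ge0. Qed.

Let cons_measure_sigma_additive : semi_sigma_additive cons_measure.
Proof.
move=> F mF tF mUF; rewrite /cons_measure /pushforward preimage_bigcup.
apply: measure_semi_sigma_additive.
- by move=> k; rewrite -[X in measurable X]setTI; exact: measurable_cons_pair.
- apply/trivIsetP => /= i j _ _ ij; rewrite -preimage_setI.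
  by move/trivIsetP : tF => /(_ _ _ _ _ ij) ->//; rewrite preimage_set0.
- by rewrite -preimage_bigcup -[X in measurable X]setTI;
    exact: measurable_cons_pair.
Qed.

HB.instance Definition _ := isMeasure.Build _ _ _ cons_measure
  cons_measure0 cons_measure_ge0 cons_measure_sigma_additive.

Let cons_measure_sigma_finite : sigma_finite setT cons_measure.
Proof.
have /sigma_finiteP[F [TF ndF Foo]] := sigma_finiteT m1.
have /sigma_finiteP[G [TG ndG Goo]] := sigma_finiteT m2.
pose split_tuple (t : n.+1.-tuple T) := (thead t, [tuple of behead t]).
have msplit : measurable_fun setT split_tuple.
  apply/measurable_fun_pairP; split; last exact: measurable_behead.
  exact: measurable_tnth.
have cons_pairK : cancel cons_pair split_tuple.
  by case=> x t; congr pair; apply: val_inj.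
exists (fun k => split_tuple @^-1` (F k `*` G k)).
  apply/esym; rewrite -subTset => t _.
  have [i _ Fi] : (\bigcup_k F k) (thead t) by rewrite -TF.
  have [j _ Gj] : (\bigcup_k G k) [tuple of behead t] by rewrite -TG.
  exists (maxn i j) => //; split.
    exact: (subsetPset _ _ (ndF _ _ (leq_maxl i j)) _ Fi).
  exact: (subsetPset _ _ (ndG _ _ (leq_maxr i j)) _ Gj).
move=> k; have [mF Fk] := Foo k; have [mG Gk] := Goo k; split.
  by rewrite -[X in measurable X]setTI; apply: msplit => //; exact: measurableX.
rewrite /cons_measure /pushforward -comp_preimage.
have -> : split_tuple \o cons_pair = id by apply/funext; exact: cons_pairK.
by rewrite preimage_id product_measure1E// lte_mul_pinfty// ge0_fin_numE.
Qed.

HB.instance Definition _ := Measure_isSigmaFinite.Build _ _ _ cons_measure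
  cons_measure_sigma_finite.

End cons_measure.

(* The n-dimensional Lebesgue measure.  It lives on tuples, because the library
   equips n.-tuple T, but not 'rV[R]_n, with the product sigma-algebra. *)
Fixpoint lebesgue_measure_tuple (R : realType) (n : nat) :
    {sigma_finite_measure set (n.-tuple (measurableTypeR R)) -> \bar R} :=
  match n with
  | 0 => \d_ ([tuple] : 0.-tuple (measurableTypeR R))
  | k.+1 => cons_measure (@lebesgue_measure R) (lebesgue_measure_tuple R k)
  end.

Section operators.
Context {R : realType} {n : nat}.
Implicit Types (A Omega : set 'rV[R]_n) (rho u : 'rV[R]_n -> R).

Definition row_of_tuple (t : n.-tuple (measurableTypeR R)) : 'rV[R]_n :=
  \row_i tnth t i.

Definition mean A u : R :=
  (fine (lebesgue_measure_tuple R n (row_of_tuple @^-1` A)))^-1 *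
  Rintegral (lebesgue_measure_tuple R n) (row_of_tuple @^-1` A)
    (u \o row_of_tuple).

(* The operators act on all functions 'rV[R]_n -> R, and leave the values
   outside Omega unchanged; for functions on closure Omega this is the
   convention that they fix the boundary values. *)
Definition midrange_op Omega rho u : 'rV[R]_n -> R := fun x =>
  if x \in Omega then
    2^-1 * sup [set u y | y in eucl_ball x (rho x)] +
    2^-1 * inf [set u y | y in eucl_ball x (rho x)]
  else u x.

Definition mean_op Omega rho u : 'rV[R]_n -> R := fun x =>
  if x \in Omega then mean (eucl_ball x (rho x)) u else u x.

Definition tug_op Omega rho (p : R) u : 'rV[R]_n -> R := fun x =>
  (p - 2) / (n%:R + p) * midrange_op Omega rho u x +
  (n%:R + 2) / (n%:R + p) * mean_op Omega rho u x.

Definition admissible_radius Omega rho : Prop :=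
  [/\ forall x, closure Omega x -> 0 <= rho x,
      forall x, Omega x -> 0 < rho x <= dist_to (boundary Omega) x &
      forall x, closure Omega x -> (rho x = 0 <-> boundary Omega x)].

Definition norm_preserving_extension Omega (f u : 'rV[R]_n -> R) : Prop :=
  [/\ {within closure Omega, continuous u},
      forall x, boundary Omega x -> u x = f x &
      sup_norm Omega u = sup_norm (boundary Omega) f].

Definition dirichlet_solution Omega rho (p : R) (f u : 'rV[R]_n -> R) : Prop :=
  [/\ {within closure Omega, continuous u},
      forall x, Omega x -> tug_op Omega rho p u x = u x &
      forall x, boundary Omega x -> u x = f x].

End operators.

(* Main.v *)
Require Import Defs.
From mathcomp Require Import all_boot all_order all_algebra.
From mathcomp Require Import all_classical all_reals all_analysis.
From mathcomp Require Import measurable_realfun ring lra zify.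
Import Order.TTheory GRing.Theory Num.Theory.
Import numFieldNormedType.Exports.
Local Open Scope classical_set_scope.
Local Open Scope ring_scope.

(** Rescaling each ball to the unit ball [D] writes the operator, at any point [x]
    of the closure, boundary points included, as
    [T u x = tug_avg p (fun h => u (x + rho x *: h))] ([tug_opE]), where the
    functional [tug_avg] is monotone and commutes with the addition of constants
    ([tug_avg_le]).  Hence [T] is nonexpansive, and it preserves uniform
    continuity, because [x + rho x *: h] depends on [x] uniformly in [h].  The
    rescaling rests on the affine change of variables for Lebesgue measure
    ([lebesgue_measure_tuple_affine]).

    The theorem is reduced to one statement about two functions [u] and [v] that
    are continuous on the closure and agree on the boundary: for large [j] and [k]
    and for close [y] and [y'], the difference of [iter j T u y] and
    [iter k T v y'] is small ([iterates_close]).  With [u = v] this makes the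
    iterates of one extension of the boundary data a uniform Cauchy sequence,
    whose limit is a solution ([fixed_exists]); with a fixed point for [v] it says
    that the iterates of every extension converge to [v] ([iterates_to_fixed]);
    with two fixed points it is uniqueness ([fixed_unique]).

    The statement is proved by a maximum principle for the limit superior of the
    difference ([iterates_comparison]).  If this limit is positive, then it is
    approached near the points of a compact set.  In the interior the mean, whose
    weight is positive, is strictly monotone ([tug_avg_strict]) and spreads this
    set to whole balls, which is impossible.  So the set would have to meet the
    boundary, and there the iterates take the boundary values uniformly in the
    number of iterations ([iterates_le_near_boundary]).

    The last fact comes from a barrier.  The function [- exp (- m |x - z| ^ 2)] is
    a supersolution at all points where [m |x - z| ^ 2] is large and the ball of
    the operator does not contain [z] ([gauss_tug_avg]): the two parts of the
    operator are estimated by elementary inequalities for the exponential, in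
    which the linear terms cancel by the symmetry of the ball.  The cone condition
    provides, at each scale, a center [z] with an exterior ball around it
    ([cone_corkscrew]), and the corresponding barrier reduces the excess of the
    iterates over the boundary value by a constant factor from one scale to the
    next ([barrier_step]). *)

Set Implicit Arguments.
Unset Strict Implicit.
Unset Printing Implicit Defensive.

(** * Euclidean geometry of row vectors *)

Section euclidean_geometry.
Context {R : realType} {n : nat}.
Implicit Types (x y z : 'rV[R]_n) (r : R).

Definition dot x y : R := \sum_i x 0 i * y 0 i.

Lemma dotC x y : dot x y = dot y x.
Proof. by apply: eq_bigr => i _; rewrite mulrC. Qed.

Lemma dotDr x y z : dot x (y + z) = dot x y + dot x z.
Proof. by rewrite -big_split/=; apply: eq_bigr => i _; rewrite mxE mulrDr. Qed.

Lemma dotZr x r y : dot x (r *: y) = r * dot x y.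
Proof. by rewrite big_distrr/=; apply: eq_bigr => i _; rewrite mxE mulrCA. Qed.

Lemma dotNr x y : dot x (- y) = - dot x y.
Proof. by rewrite -scaleN1r dotZr mulN1r. Qed.

Lemma eucl_norm_ge0 x : 0 <= eucl_norm x.
Proof. exact: sqrtr_ge0. Qed.

Lemma eucl_norm_sqr x : eucl_norm x ^+ 2 = dot x x.
Proof.
rewrite sqr_sqrtr; last by apply: sumr_ge0 => i _; exact: sqr_ge0.
by apply: eq_bigr => i _; rewrite expr2.
Qed.

Lemma eucl_normDsqr x y :
  eucl_norm (x + y) ^+ 2 = eucl_norm x ^+ 2 + 2 * dot x y + eucl_norm y ^+ 2.
Proof.
by rewrite !eucl_norm_sqr dotDr dotC dotDr [dot (x + y) y]dotC dotDr (dotC y x); ring.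
Qed.

Lemma eucl_normZ r x : eucl_norm (r *: x) = `|r| * eucl_norm x.
Proof.
apply: (@pexpIrn _ 2); rewrite ?nnegrE ?mulr_ge0 ?eucl_norm_ge0//.
by rewrite exprMn !eucl_norm_sqr dotZr dotC dotZr real_normK ?num_real// mulrA expr2.
Qed.

Lemma eucl_normN x : eucl_norm (- x) = eucl_norm x.
Proof. by rewrite -scaleN1r eucl_normZ normrN1 mul1r. Qed.

Lemma eucl_normB x y : eucl_norm (x - y) = eucl_norm (y - x).
Proof. by rewrite -eucl_normN opprB. Qed.

Lemma eucl_norm0 : eucl_norm (0 : 'rV[R]_n) = 0.
Proof. by rewrite -(scale0r 0) eucl_normZ normr0 mul0r. Qed.

Lemma dot_le x y : dot x y <= eucl_norm x * eucl_norm y.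
Proof.
have x0 := eucl_norm_ge0 x; have y0 := eucl_norm_ge0 y.
have /predU1P[xy0|xy_gt0] : (0 == eucl_norm x * eucl_norm y)
    || (0 < eucl_norm x * eucl_norm y).
- by rewrite -le_eqVlt mulr_ge0.
- have coord0 z : eucl_norm z = 0 -> forall i, z 0 i = 0.
    move=> /eqP; rewrite -sqrf_eq0 eucl_norm_sqr.
    rewrite psumr_eq0 => [|i _]; last by rewrite -expr2 sqr_ge0.
    move=> /allP z0 i; apply/eqP; rewrite -sqrf_eq0 expr2.
    exact: (z0 i (mem_index_enum i)).
  rewrite -xy0 le_eqVlt; apply/orP; left; apply/eqP; apply: big1 => i _.
  by move/esym/eqP: xy0; rewrite mulf_eq0 => /orP[]/eqP/coord0 ->;
    rewrite ?mul0r ?mulr0.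
- have : 0 <= eucl_norm (eucl_norm y *: x + (- eucl_norm x) *: y) ^+ 2.
    exact: sqr_ge0.
  rewrite eucl_normDsqr !eucl_normZ dotZr dotC dotZr normrN !ger0_norm// dotC.
  move=> h; rewrite -(ler_pM2l xy_gt0); nra.
Qed.

Lemma dot_ge x y : - (eucl_norm x * eucl_norm y) <= dot x y.
Proof. by rewrite lerNl -dotNr -(eucl_normN y) dot_le. Qed.

Lemma eucl_normD x y : eucl_norm (x + y) <= eucl_norm x + eucl_norm y.
Proof.
rewrite -ler_sqr ?nnegrE ?addr_ge0 ?eucl_norm_ge0// eucl_normDsqr.
have := dot_le x y; nra.
Qed.

Lemma eucl_dist_triangle z x y :
  eucl_norm (x - y) <= eucl_norm (x - z) + eucl_norm (z - y).
Proof. by rewrite (_ : x - y = (x - z) + (z - y)) ?eucl_normD// addrA subrK. Qed.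

Lemma coord_le_eucl_norm x i : `|x 0 i| <= eucl_norm x.
Proof.
rewrite -ler_sqr ?nnegrE ?eucl_norm_ge0// real_normK ?num_real// eucl_norm_sqr.
rewrite /dot (bigD1 i)//= -expr2 lerDl; apply: sumr_ge0 => j _.
by rewrite -expr2 sqr_ge0.
Qed.

Lemma norm_le_eucl_norm x : `|x| <= eucl_norm x.
Proof.
rewrite [leLHS]/Num.norm/= mx_normrE; apply/bigmax_leP; split => [|[i j] _ /=].
  exact: eucl_norm_ge0.
by rewrite ord1 coord_le_eucl_norm.
Qed.

Lemma coord_le_norm x i : `|x 0 i| <= `|x|.
Proof.
rewrite [leRHS]/Num.norm/= mx_normrE; apply/bigmax_geP; right.
by exists (0, i).
Qed.

Lemma eucl_norm_le_coord x r :
  0 <= r -> (forall i, `|x 0 i| <= r) -> eucl_norm x <= n%:R * r.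
Proof.
move=> r0 xr; rewrite -ler_sqr ?nnegrE ?eucl_norm_ge0 ?mulr_ge0 ?ler0n//.
rewrite eucl_norm_sqr exprMn.
apply: (@le_trans _ _ (n%:R * r ^+ 2)).
  rewrite (_ : n%:R * r ^+ 2 = \sum_(i < n) r ^+ 2); last first.
    by rewrite sumr_const card_ord mulr_natl.
  apply: ler_sum => i _.
  by rewrite -expr2 -real_normK ?num_real// ler_sqr ?nnegrE.
rewrite ler_wpM2r ?sqr_ge0// -natrX ler_nat.
by case: n => // m; rewrite expnS leq_pmulr// expn1.
Qed.

Lemma eucl_norm_le_norm x : eucl_norm x <= n%:R * `|x|.
Proof. by apply: eucl_norm_le_coord => // i; exact: coord_le_norm. Qed.

Lemma eucl_norm_delta i : eucl_norm (delta_mx 0 i : 'rV[R]_n) = 1.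
Proof.
rewrite /eucl_norm (bigD1 i)//= big1 ?mxE ?eqxx ?expr1n ?addr0 ?sqrtr1//.
by move=> j /negbTE ji; rewrite mxE ji andbF expr0n.
Qed.

Lemma nbhs_eucl_ballP x (A : set 'rV[R]_n) :
  nbhs x A <-> exists2 e : R, 0 < e & eucl_ball x e `<=` A.
Proof.
split=> [/nbhs_ballP[e /= e0 eA]|[e e0 eA]].
  exists e => // y /= xy; apply: eA; rewrite -ball_normE/= distrC.
  exact: le_lt_trans (norm_le_eucl_norm _) xy.
apply/nbhs_ballP; exists (e / n.+1%:R) => /=; first by rewrite divr_gt0.
move=> y; rewrite -ball_normE/= => xy; apply: eA; rewrite /eucl_ball/= eucl_normB.
apply: le_lt_trans (eucl_norm_le_norm _) _.
apply: (@le_lt_trans _ _ (n.+1%:R * `|x - y|)).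
  by rewrite ler_wpM2r// ler_nat.
by rewrite mulrC -ltr_pdivlMr.
Qed.

Lemma eucl_ball_center x r : 0 < r -> eucl_ball x r x.
Proof. by move=> r0; rewrite /eucl_ball/= subrr eucl_norm0. Qed.

Lemma eucl_ball_nbhs x r : 0 < r -> nbhs x (eucl_ball x r).
Proof. by move=> r0; apply/nbhs_eucl_ballP; exists r. Qed.

Lemma eucl_ball_open x r : open (eucl_ball x r).
Proof.
rewrite openE => y xy; apply/nbhs_eucl_ballP.
exists (r - eucl_norm (y - x)) => [|z]; first by rewrite subr_gt0.
rewrite /eucl_ball/= => zy; apply: le_lt_trans (eucl_dist_triangle y _ _) _.
by rewrite -ltrBrDr.
Qed.

Lemma openP_eucl (A : set 'rV[R]_n) : open A <->
  forall x, A x -> exists2 e : R, 0 < e & eucl_ball x e `<=` A.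
Proof.
rewrite openE; split=> h x Ax; first exact/nbhs_eucl_ballP/h.
exact/nbhs_eucl_ballP/h.
Qed.

Lemma closureP_eucl (A : set 'rV[R]_n) x : closure A x <->
  forall e : R, 0 < e -> exists2 y, A y & eucl_norm (y - x) < e.
Proof.
split=> [clA e e0|h B /nbhs_eucl_ballP[e e0 eB]].
  by have [y [Ay xy]] := clA _ (eucl_ball_nbhs x e0); exists y.
by have [y Ay xy] := h e e0; exists y; split => //; exact: eB.
Qed.

End euclidean_geometry.

(** * Uniform continuity on compact sets *)

Section uniform_continuity.
Context {R : realType} {n : nat}.
Implicit Types (K : set 'rV[R]_n) (f g : 'rV[R]_n -> R).

Definition ucont K f := forall e : R, 0 < e -> exists2 d : R, 0 < d &
  forall x y, K x -> K y -> eucl_norm (x - y) < d -> `|f x - f y| < e.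

Lemma invSn_lt (d : R) :
  0 < d -> exists N, forall m, (N <= m)%N -> m.+1%:R^-1 < d.
Proof.
move=> /ltr_add_invr[N]; rewrite add0r => Nd; exists N => m Nm.
by apply: le_lt_trans Nd; rewrite lef_pV2 ?posrE// ler_nat.
Qed.

(** Compactness, for properties indexed by an integer: finitely many of the given
    neighborhoods cover [K], and they have a common threshold. *)
Lemma near_compact_eucl K (P : nat -> 'rV[R]_n -> Prop) : compact K ->
  (forall x, K x -> exists2 d : R, 0 < d & exists N, forall y m,
     K y -> (N <= m)%N -> eucl_norm (y - x) < d -> P m y) ->
  exists N, forall m y, (N <= m)%N -> K y -> P m y.
Proof.
move=> /compact_near_coveringP cK h.
have [x Kx|N _ NP] := cK nat \oo (fun m y => K y -> P m y) _.
- have [d d0 [N NP]] := h x Kx.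
  exists (eucl_ball x d, [set m | (N <= m)%N]); first split.
  + exact: eucl_ball_nbhs.
  + by exists N.
  + by case=> y m /= [yx Nm] Ky; exact: NP.
by exists N => m y Nm Ky; exact: NP.
Qed.

Lemma ucont_within K f : ucont K f -> {within K, continuous f}.
Proof.
move=> uf; apply/subspace_continuousP => x Kx.
apply/cvgrPdist_lt => e e0; have [d d0 fd] := uf e e0.
rewrite near_withinE; apply/nbhs_eucl_ballP; exists d => // y yx Ky.
by apply: fd => //; rewrite eucl_normB.
Qed.

Lemma within_ucont K f : compact K -> {within K, continuous f} -> ucont K f.
Proof.
move=> cK /subspace_continuousP cf e e0.
pose P m y := forall z, K z -> eucl_norm (y - z) < m.+1%:R^-1 -> `|f y - f z| < e.
have [x Kx|N NP] := @near_compact_eucl K P cK.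
  have /cvgrPdist_lt/(_ (e / 2)) := cf x Kx.
  rewrite divr_gt0// => /(_ isT); rewrite near_withinE => /nbhs_eucl_ballP[d d0 fd].
  have d20 : 0 < d / 2 by rewrite divr_gt0.
  have [N Nd] := invSn_lt d20.
  exists (d / 2) => //; exists N => y m Ky Nm yx z Kz yz.
  have fy : `|f x - f y| < e / 2.
    by apply: fd => //; apply: lt_trans yx _; rewrite ltr_pdivrMr// ltr_pMr// ltr1n.
  have fz : `|f x - f z| < e / 2.
    apply: fd => //; rewrite /eucl_ball/=; apply: le_lt_trans (eucl_dist_triangle y _ _) _.
    rewrite [ltRHS]splitr ltrD// eucl_normB.
    exact: lt_trans yz (Nd _ Nm).
  rewrite [e]splitr (_ : f y - f z = - (f x - f y) + (f x - f z)); last by ring.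
  by apply: le_lt_trans (ler_normD _ _) _; rewrite normrN ltrD.
exists N.+1%:R^-1 => [|x y Kx Ky]; first by rewrite invr_gt0.
exact: (NP N).
Qed.

Lemma ucont_bounded K (f : 'rV[R]_n -> R) : compact K -> ucont K f ->
  exists C, forall x, K x -> `|f x| <= C.
Proof.
move=> cK uf.
have [x Kx|N NP] := @near_compact_eucl K (fun m y => `|f y| <= m%:R) cK.
  have [d d0 fd] := uf 1 ltr01; exists d => //.
  exists (Num.bound (`|f x| + 1)) => y m Ky Nm yx.
  have := fd y x Ky Kx yx => fyx.
  have -> : f y = (f y - f x) + f x by rewrite subrK.
  apply: le_trans (ler_normD _ _) _.
  apply: (@le_trans _ _ (`|f x| + 1)); first by rewrite addrC lerD2l ltW.
  apply: (@le_trans _ _ ((Num.bound (`|f x| + 1)))%:R).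
    by rewrite ltW// archi_boundP// addr_ge0.
  by rewrite ler_nat.
by exists N%:R => x Kx; exact: (NP N).
Qed.

Lemma ucontN K f : ucont K f -> ucont K (fun x => - f x).
Proof.
move=> uf e /uf[d d0 fd]; exists d => // x y Kx Ky /(fd x y Kx Ky).
by rewrite -opprD normrN.
Qed.

End uniform_continuity.

(** * Affine change of variables for Lebesgue measure *)

Section affine_change.
Context {R : realType}.
Local Notation leb := (lebesgue_measure_tuple R).

Lemma lebesgue_measure_affine (a r : R) (A : set (measurableTypeR R)) :
  r != 0 -> measurable A ->
  lebesgue_measure ((fun t => a + r * t) @^-1` A) =
  (`|r|^-1%:E * lebesgue_measure A)%E.
Proof.
move=> r0 mA; pose phi : measurableTypeR R -> measurableTypeR R :=
  fun t => a + r * t.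
have mphi : measurable_fun setT phi.
  by apply: measurable_funD => //; exact: mulrl_measurable.
pose k : {nonneg R} := NngNum (normr_ge0 r).
pose m := @mscale _ _ R k
  (measure_function_pushforward__canonical__measure_function_Measure
     (@lebesgue_measure R) mphi).
have -> : lebesgue_measure A = m A.
  apply: (lebesgue_measure_unique (mu := m)) => // _ [[c d]] _ <-.
  rewrite lebesgue_measure_itv/=.
  transitivity (`|r|%:E * lebesgue_measure (phi @^-1` `]c, d]))%E; last by [].
  have r'0 : 0 < `|r| by rewrite normr_gt0.
  have [rp|rn|/eqP] := ltgtP 0 r; last by rewrite eq_sym (negbTE r0).
  - rewrite (_ : phi @^-1` _ = [set` `](c - a) / r, (d - a) / r] ]).
      rewrite lebesgue_measure_itv/= !lte_fin ltr_pM2r ?invr_gt0// ltrD2r.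
      case: ifP => _; last by rewrite mule0.
      rewrite -EFinB -EFinM gtr0_norm//; congr EFin; field; exact: r0.
    apply/seteqP; split => t /=; rewrite !in_itv/= ltr_pdivrMr// ler_pdivlMr//;
      rewrite /phi ltrBlDl lerBrDl (mulrC t) //.
  - rewrite (_ : phi @^-1` _ = [set` `[(d - a) / r, (c - a) / r[ ]).
      rewrite lebesgue_measure_itv/= !lte_fin ltr_nM2r ?invr_lt0// ltrD2r.
      case: ifP => _; last by rewrite mule0.
      rewrite -EFinB -EFinM ltr0_norm//; congr EFin; field; exact: r0.
    apply/seteqP; split => t /=; rewrite !in_itv/= ltr_ndivlMr// ler_ndivrMr//;
      by rewrite /phi ltrBlDl lerBrDl (mulrC t) andbC.
rewrite (_ : m A = (`|r|%:E * lebesgue_measure (phi @^-1` A))%E)//.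
by rewrite muleA -EFinM mulVf ?normr_eq0// mul1e.
Qed.

Definition affine_tuple n (a : 'rV[R]_n) (r : R)
    (t : n.-tuple (measurableTypeR R)) : n.-tuple (measurableTypeR R) :=
  [tuple a 0 i + r * tnth t i | i < n].

Lemma measurable_affine_tuple n (a : 'rV[R]_n) r :
  measurable_fun setT (affine_tuple a r).
Proof.
apply/measurable_fun_tnthP => i.
rewrite (_ : _ \o _ = fun t => a 0 i + r * tnth t i); last first.
  by apply/funext => t /=; rewrite tnth_mktuple.
apply: measurable_funD => //; apply: measurable_funM => //.
exact: measurable_tnth.
Qed.

Lemma row_affine_tuple n (a : 'rV[R]_n) r t :
  row_of_tuple (affine_tuple a r t) = a + r *: row_of_tuple t.
Proof. by apply/rowP => i; rewrite !mxE tnth_mktuple. Qed.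

Lemma lebesgue_measure_tupleS n (A : set (n.+1.-tuple (measurableTypeR R))) :
  leb n.+1 A = (@lebesgue_measure R \x leb n)%E
    ((fun z : R * n.-tuple (measurableTypeR R) => [tuple of z.1 :: z.2]) @^-1` A).
Proof. by []. Qed.

(** In each dimension the measure is a product, and the change of variables acts
    on the factors separately, so it is enough to look at rectangles. *)
Lemma lebesgue_measure_tuple_affine n (a : 'rV[R]_n) r A :
  r != 0 -> measurable A ->
  leb n (affine_tuple a r @^-1` A) = ((`|r| ^+ n)^-1%:E * leb n A)%E.
Proof.
move=> r0; elim: n a A => [|n IHn] a A mA.
  rewrite expr0 invr1 mul1e; congr (leb 0 _); apply/seteqP; split => t /=.
    by rewrite (tuple0 t) [X in A X](tuple0 _).
  by rewrite (tuple0 t) [X in _ -> A X](tuple0 _).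
pose a' : 'rV[R]_n := \row_i a 0 (lift ord0 i).
pose phi (z : measurableTypeR R * n.-tuple (measurableTypeR R)) :=
  (a 0 0 + r * z.1 : measurableTypeR R, affine_tuple a' r z.2).
pose consp (z : measurableTypeR R * n.-tuple (measurableTypeR R)) :=
  [tuple of z.1 :: z.2] : n.+1.-tuple (measurableTypeR R).
have mconsp : measurable_fun setT consp by exact: measurable_cons.
have mphi : measurable_fun setT phi.
  apply/measurable_fun_pairP; split.
    by apply: measurable_funD => //; apply: measurable_funM => //.
  exact: (measurableT_comp (measurable_affine_tuple a' r) measurable_snd).
pose k : {nonneg R} := NngNum (exprn_ge0 n.+1 (normr_ge0 r)).
rewrite !lebesgue_measure_tupleS -/consp.
have mcA : measurable (consp @^-1` A).
  by rewrite -[X in measurable X]setTI; exact: mconsp.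
pose m := @mscale _ _ R k
  (measure_function_pushforward__canonical__measure_function_Measure
     (@lebesgue_measure R \x leb n)%E mphi).
have mE B : m B = ((`|r| ^+ n.+1)%:E *
    (@lebesgue_measure R \x leb n) (phi @^-1` B))%E by [].
have -> : (@lebesgue_measure R \x leb n)%E (consp @^-1` A) = m (consp @^-1` A).
  apply: (product_measure_unique (m' := m) _ mcA) => B C mB mC.
  transitivity ((`|r| ^+ n.+1)%:E *
    (@lebesgue_measure R \x leb n) (phi @^-1` (B `*` C)))%E; first by [].
  rewrite (_ : phi @^-1` _ = ((fun t => a 0 0 + r * t) @^-1` B)
      `*` (affine_tuple a' r @^-1` C)); last by [].
  have mf : measurable_fun setT
      (fun t : measurableTypeR R => a 0 0 + r * t : measurableTypeR R).
    by apply: measurable_funD => //; exact: mulrl_measurable.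
  have mB' : measurable ((fun t => a 0 0 + r * t) @^-1` B).
    by rewrite -[X in measurable X]setTI; exact: mf.
  have mC' : measurable (affine_tuple a' r @^-1` C).
    by rewrite -[X in measurable X]setTI; exact: measurable_affine_tuple.
  rewrite product_measure1E//.
  transitivity ((`|r| ^+ n.+1)%:E * ((`|r|^-1%:E * @lebesgue_measure R B) *
      ((`|r| ^+ n)^-1%:E * leb n C)))%E.
    congr (_ * (_ * _))%E; first exact: lebesgue_measure_affine.
    exact: IHn.
  rewrite muleACA muleA -!EFinM exprS.
  rewrite !muleA -EFinM -invfM mulfV ?mul1e//.
  by rewrite mulf_neq0 ?expf_neq0 ?normr_eq0.
rewrite mE muleA -EFinM mulVf ?mul1e; last first.
  by rewrite expf_neq0// normr_eq0.
congr (_ _); apply/seteqP.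
have h z : affine_tuple a r (consp z) = consp (phi z).
  apply: eq_from_tnth => i; rewrite tnth_mktuple.
  have [->|i0] := eqVneq i ord0; first by rewrite !tnth0.
  have [j ->] : exists j, i = lift ord0 j.
    by have [j|/eqP] := unliftP ord0 i; [exists j|rewrite (negbTE i0)].
  by rewrite !tnthS tnth_mktuple mxE.
by split=> z; rewrite /preimage/= h.
Qed.

End affine_change.

(** * Measurability and measure of balls *)

Section ball_measure.
Context {R : realType}.
Local Notation leb := (lebesgue_measure_tuple R).

Lemma measurable_cube n (a b : 'I_n -> R) :
  measurable [set t : n.-tuple (measurableTypeR R) | forall i, a i < tnth t i < b i].
Proof.
rewrite (_ : mkset _ = \bigcap_(i in [set: 'I_n])
   ((fun t : n.-tuple (measurableTypeR R) => tnth t i) @^-1` `]a i, b i[)).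
  apply: fin_bigcap_measurable => // i _.
  rewrite -[X in measurable X]setTI.
  exact: (measurable_tnth i measurableT (measurable_itv _)).
apply/seteqP; split => t /= ht i; first by move=> _; rewrite /= in_itv/=.
by have := ht i I; rewrite /= in_itv/=.
Qed.

Lemma lebesgue_measure_cube n (e : R) : 0 < e ->
  leb n [set t | forall i, - e < tnth t i < e] = ((2 * e) ^+ n)%:E.
Proof.
move=> e0; elim: n => [|n IHn].
  rewrite (_ : mkset _ = setT); first by rewrite /= diracT.
  by apply/seteqP; split => t _ //= [].
rewrite lebesgue_measure_tupleS.
rewrite (_ : _ @^-1` _ = `]- e, e[%classic `*`
    [set t : n.-tuple (measurableTypeR R) | forall i, - e < tnth t i < e]).
  rewrite product_measure1E; last first.
  - exact: measurable_cube.
  - exact: measurable_itv.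
  rewrite exprS EFinM; congr (_ * _)%E; last exact: IHn.
  transitivity (@lebesgue_measure R `]- e, e[); first by [].
  rewrite lebesgue_measure_itv/= lte_fin ifT; last by lra.
  by rewrite -EFinB; congr EFin; ring.
apply/seteqP; split => -[x t] /=.
  move=> h; split; first by have := h ord0; rewrite tnth0 in_itv.
  by move=> i; have := h (lift ord0 i); rewrite tnthS.
rewrite in_itv/= => -[xe te] i.
have [->|i0] := eqVneq i ord0; first by rewrite tnth0.
have [j ->] : exists j, i = lift ord0 j.
  by have [j|/eqP] := unliftP ord0 i; [exists j|rewrite (negbTE i0)].
by rewrite tnthS.
Qed.

(** The sigma-algebra on tuples is a product, while the topology on row vectors
    comes from a norm.  They match because an open set is the union of the
    countably many cubes with rational corners that it contains. *)
Lemma measurable_row_preimage n (U : set 'rV[R]_n) :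
  open U -> measurable (@row_of_tuple R n @^-1` U).
Proof.
move=> /openP_eucl oU.
pose cube (s : n.-tuple rat * n.-tuple rat) : set (n.-tuple (measurableTypeR R)) :=
  [set t | forall i, ratr (tnth s.1 i) < tnth t i < ratr (tnth s.2 i)].
pose F s := if asbool (cube s `<=` @row_of_tuple R n @^-1` U) then cube s else set0.
rewrite (_ : _ @^-1` _ = \bigcup_s F s).
  apply: countable_bigcupT_measurable => // s; rewrite /F.
  by case: ifP => _ //; exact: measurable_cube.
apply/seteqP; split => t; last first.
  by move=> [s _]; rewrite /F; case: ifP => // /asboolP; apply.
move=> /= /oU[e e0 eU].
pose d : R := e / n.+1%:R.
have d0 : 0 < d by rewrite divr_gt0.
have lo i : {q : rat | tnth t i - d < ratr q < tnth t i}.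
  by apply: cid; have /rat_in_itvoo[q] : tnth t i - d < tnth t i;
    [rewrite ltrBlDr ltrDl|rewrite in_itv/=; exists q].
have hi i : {q : rat | tnth t i < ratr q < tnth t i + d}.
  by apply: cid; have /rat_in_itvoo[q] : tnth t i < tnth t i + d;
    [rewrite ltrDl|rewrite in_itv/=; exists q].
exists ([tuple sval (lo i) | i < n], [tuple sval (hi i) | i < n]) => //.
have ct : cube ([tuple sval (lo i) | i < n], [tuple sval (hi i) | i < n]) t.
  move=> i /=; rewrite !tnth_mktuple.
  by have /andP[_ ->] := svalP (lo i); have /andP[-> _] := svalP (hi i).
rewrite /F ifT//; apply/asboolP => t' ct'; apply: eU; rewrite /eucl_ball/=.
apply: (@le_lt_trans _ _ (n%:R * d)).
  apply: eucl_norm_le_coord => [|i]; first exact: ltW.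
  have /andP[lo1 lo2] := svalP (lo i); have /andP[hi1 hi2] := svalP (hi i).
  have := ct' i; rewrite /= !tnth_mktuple => /andP[t1 t2].
  by rewrite !mxE ler_norml; apply/andP; split; lra.
by rewrite /d mulrCA gtr_pMr// ltr_pdivrMr// mul1r ltr_nat.
Qed.

Variable n : nat.
Local Notation D := (eucl_ball (0 : 'rV[R]_n) 1).
Local Notation Dt := (@row_of_tuple R n @^-1` D).

Lemma measurable_eucl_ball (x : 'rV[R]_n) r :
  measurable (@row_of_tuple R n @^-1` eucl_ball x r).
Proof. by apply: measurable_row_preimage; exact: eucl_ball_open. Qed.

Lemma lebesgue_measure_ball_fin : (leb n Dt < +oo)%E.
Proof.
apply: (@le_lt_trans _ _ (leb n [set t | forall i, - 1 < tnth t i < 1])).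
  apply: le_measure; rewrite ?inE; [exact: measurable_eucl_ball|exact: measurable_cube|].
  move=> t; rewrite /eucl_ball/= subr0 => t1 i; rewrite -ltr_norml.
  have := coord_le_eucl_norm (row_of_tuple t) i; rewrite mxE => /le_lt_trans.
  exact.
by rewrite lebesgue_measure_cube// ltry.
Qed.

Lemma lebesgue_measure_ball_gt0 : (0 < leb n Dt)%E.
Proof.
pose e : R := n.+1%:R^-1.
have e0 : 0 < e by rewrite invr_gt0.
apply: (@lt_le_trans _ _ (leb n [set t | forall i, - e < tnth t i < e])).
  by rewrite lebesgue_measure_cube// lte_fin exprn_gt0// mulr_gt0.
apply: le_measure; rewrite ?inE; [exact: measurable_cube|exact: measurable_eucl_ball|].
move=> t te; rewrite /eucl_ball/= subr0.
apply: (@le_lt_trans _ _ (n%:R * e)).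
  apply: eucl_norm_le_coord => [|i]; first exact: ltW.
  by rewrite mxE ler_norml; have /andP[/ltW -> /ltW ->] := te i.
by rewrite ltr_pdivrMr// mul1r ltr_nat.
Qed.

End ball_measure.

(** * Means over the unit ball *)

Section ball_mean.
Context {R : realType} {n : nat}.
Local Notation leb := (lebesgue_measure_tuple R n).
Local Notation row := (@row_of_tuple R n).
Local Notation D := (eucl_ball (0 : 'rV[R]_n) 1).
Local Notation Dt := (row @^-1` D).
Implicit Types (x c X : 'rV[R]_n) (F G u : 'rV[R]_n -> R).

Lemma ge0_integral_affine x (r : R) B (f : n.-tuple (measurableTypeR R) -> \bar R) :
  r != 0 -> measurable B -> measurable_fun B f -> (forall t, 0 <= f t)%E ->
  (\int[leb]_(t in B) f t = (`|r| ^+ n)%:E *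
     \int[leb]_(t in affine_tuple x r @^-1` B) (f \o affine_tuple x r) t)%E.
Proof.
move=> r0 mB mf f0.
have mphi := measurable_affine_tuple x r.
pose k : {nonneg R} := NngNum (exprn_ge0 n (normr_ge0 r)).
pose P := measure_function_pushforward__canonical__measure_function_Measure
  leb mphi.
rewrite -(ge0_integral_pushforward mphi)//.
transitivity (\int[mscale k P]_(t in B) f t)%E; last first.
  by rewrite ge0_integral_mscale.
apply: eq_measure_integral => A mA _.
transitivity ((`|r| ^+ n)%:E * leb (affine_tuple x r @^-1` A))%E; last by [].
rewrite lebesgue_measure_tuple_affine// muleA -EFinM mulfV ?mul1e//.
by rewrite expf_neq0// normr_eq0.
Qed.

Lemma Rintegral_affine x (r : R) B (g : n.-tuple (measurableTypeR R) -> R) :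
  r != 0 -> measurable B -> measurable_fun B g ->
  leb.-integrable (affine_tuple x r @^-1` B) (EFin \o g \o affine_tuple x r) ->
  Rintegral leb B g = `|r| ^+ n *
    Rintegral leb (affine_tuple x r @^-1` B) (g \o affine_tuple x r).
Proof.
move=> r0 mB mg ig; rewrite /Rintegral.
have mB' : measurable (affine_tuple x r @^-1` B).
  by rewrite -[X in measurable X]setTI; exact: measurable_affine_tuple.
have mEg : measurable_fun B (EFin \o g) by exact/measurable_EFinP.
rewrite integralE [in RHS]integralE.
rewrite (@ge0_integral_affine x r B (EFin \o g)^\+%E)//; last first.
  exact: measurable_funepos.
rewrite (@ge0_integral_affine x r B (EFin \o g)^\-%E)//; last first.
  exact: measurable_funeneg.
rewrite -funepos_comp -funeneg_comp.
have /fineK <- := integral_fune_fin_num mB' (integrable_funepos mB' ig).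
have /fineK <- := integral_fune_fin_num mB' (integrable_funeneg mB' ig).
by rewrite -!EFinM -!EFinB/= -mulrBr.
Qed.

(** The functions that are averaged below: the supremum, the infimum and the
    mean over the unit ball are all meaningful for them. *)
Definition bmeas F :=
  measurable_fun Dt (F \o row) /\ exists C, forall h, D h -> `|F h| <= C.

Lemma bmeas_integrable F : bmeas F -> leb.-integrable Dt (EFin \o (F \o row)).
Proof.
move=> [mF [C FC]]; apply: measurable_bounded_integrable => //.
- exact: measurable_eucl_ball.
- exact: lebesgue_measure_ball_fin.
- exists C; split; first exact: num_real.
  by move=> c Cc t Dt'; apply: le_trans (FC _ Dt') (ltW Cc).
Qed.

Lemma bmeasD F G : bmeas F -> bmeas G -> bmeas (fun h => F h + G h).
Proof.
move=> [mF [C FC]] [mG [C' GC]]; split; first exact: measurable_funD.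
exists (C + C') => h Dh; apply: le_trans (ler_normD _ _) _.
by rewrite lerD ?FC ?GC.
Qed.

Lemma bmeasZ F (k : R) : bmeas F -> bmeas (fun h => k * F h).
Proof.
move=> [mF [C FC]]; split; first exact: measurable_funM.
by exists (`|k| * C) => h Dh; rewrite normrM ler_wpM2l// FC.
Qed.

Lemma bmeasN F : bmeas F -> bmeas (fun h => - F h).
Proof.
move=> /(bmeasZ (-1)); congr bmeas; apply/funext => h; exact: mulN1r.
Qed.

Lemma bmeas_cst (k : R) : bmeas (fun=> k).
Proof. by split; [exact: measurable_cst|exists `|k|]. Qed.

Lemma measurable_ucont (A : set 'rV[R]_n) F :
  open A -> ucont A F -> measurable_fun (row @^-1` A) (F \o row).
Proof.
move=> oA /ucont_within; rewrite continuous_open_subspace// => cF.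
move=> mA; apply: (measurability _ (RGenOpens.measurableE R)) => // _ [_ [a [b ->] <-]].
rewrite (_ : _ `&` _ = row @^-1` (A `&` F @^-1` `]a, b[)); last by [].
apply: measurable_row_preimage.
have := (continuous_inP F oA).1 cF; apply.
exact: interval_open.
Qed.

Lemma bmeas_ucont F : ucont D F -> (exists C, forall h, D h -> `|F h| <= C) ->
  bmeas F.
Proof.
by move=> uF bF; split => //; apply: measurable_ucont => //; exact: eucl_ball_open.
Qed.

Lemma bmeas_indic c (s : R) : bmeas \1_(eucl_ball c s).
Proof.
split; last first.
  by exists 1 => h _; rewrite indicE; case: (_ \in _); rewrite ?normr1 ?normr0.
rewrite (_ : _ \o _ = \1_(row @^-1` eucl_ball c s)).
  by apply: measurable_indic; exact: measurable_eucl_ball.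
by apply/funext => t; rewrite /= !indicE; congr (_%:R); apply/idP/idP; rewrite !inE.
Qed.

Let m0 : 0 < fine (leb Dt).
Proof. by rewrite fine_gt0// lebesgue_measure_ball_gt0 lebesgue_measure_ball_fin. Qed.

Let mDt : measurable Dt. Proof. exact: measurable_eucl_ball. Qed.

Lemma mean_le F G : bmeas F -> bmeas G -> (forall h, D h -> F h <= G h) ->
  mean D F <= mean D G.
Proof.
move=> bF bG FG; rewrite /mean ler_wpM2l ?invr_ge0 ?(ltW m0)//.
apply: le_Rintegral => //; [exact: bmeas_integrable..|].
by move=> t /= /FG.
Qed.

Lemma meanD F G : bmeas F -> bmeas G ->
  mean D (fun h => F h + G h) = mean D F + mean D G.
Proof.
move=> bF bG; rewrite /mean -mulrDr; congr (_ * _).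
by rewrite -RintegralD//; exact: bmeas_integrable.
Qed.

Lemma meanZ F k : bmeas F -> mean D (fun h => k * F h) = k * mean D F.
Proof.
move=> bF; rewrite /mean mulrCA; congr (_ * _).
by rewrite -RintegralZl//; exact: bmeas_integrable.
Qed.

Lemma meanN F : bmeas F -> mean D (fun h => - F h) = - mean D F.
Proof.
move=> bF; rewrite -mulN1r -meanZ//; congr mean.
by apply/funext => h; rewrite mulN1r.
Qed.

Lemma mean_cst (k : R) : mean D (fun=> k) = k.
Proof.
rewrite /mean (_ : _ \o _ = fun=> k)// Rintegral_cst//.
by rewrite mulrCA mulVf ?mulr1// gt_eqF.
Qed.

Lemma affine_preimage_ball x c (r s : R) : 0 < r ->
  affine_tuple x r @^-1` (row @^-1` eucl_ball (x + r *: c) (r * s)) =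
  row @^-1` eucl_ball c s.
Proof.
move=> r0; apply/seteqP.
have h t : eucl_norm (row (affine_tuple x r t) - (x + r *: c)) =
    r * eucl_norm (row t - c).
  rewrite row_affine_tuple (_ : _ - _ = r *: (row t - c)) ?eucl_normZ.
    by rewrite gtr0_norm.
  by rewrite scalerBr opprD addrACA subrr add0r.
by split => t; rewrite /eucl_ball/= h ltr_pM2l.
Qed.

(** The affine change of variables gives the relative measure of a small ball,
    although the volume of the unit ball is never computed. *)
Lemma mean_indic_ball c (s : R) : 0 < s -> eucl_ball c s `<=` D ->
  mean D \1_(eucl_ball c s) = s ^+ n.
Proof.
move=> s0 sub; rewrite /mean.
rewrite (_ : _ \o _ = \1_(row @^-1` eucl_ball c s)); last first.
  by apply/funext => t; rewrite /= !indicE; congr (_%:R); apply/idP/idP; rewrite !inE.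
have -> : Rintegral leb Dt \1_(row @^-1` eucl_ball c s) =
    fine (leb (row @^-1` eucl_ball c s)).
  rewrite /Rintegral integral_indic//; last exact: measurable_eucl_ball.
  by congr (fine (leb _)); apply/setIidPl => t /= /sub.
have := @affine_preimage_ball c 0 s 1 s0; rewrite scaler0 addr0 mulr1 => e.
have sn0 : s != 0 by rewrite gt_eqF.
rewrite -[in X in X^-1 * _]e lebesgue_measure_tuple_affine//; last first.
  exact: measurable_eucl_ball.
rewrite gtr0_norm//.
have fB : leb (row @^-1` eucl_ball c s) \is a fin_num.
  rewrite ge0_fin_numE//; apply: le_lt_trans (lebesgue_measure_ball_fin n).
  apply: le_measure; rewrite ?inE//; first exact: measurable_eucl_ball.
  by move=> t /= /sub.
rewrite fineM//= invfM invrK -mulrA mulVf ?mulr1//.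
have : leb Dt != 0%E by rewrite gt_eqF// lebesgue_measure_ball_gt0.
rewrite -e lebesgue_measure_tuple_affine//; last exact: measurable_eucl_ball.
by rewrite fine_eq0//; apply: contra => /eqP ->; rewrite mule0.
Qed.

Lemma mean_ball x (r : R) u : 0 < r ->
  measurable_fun (row @^-1` eucl_ball x r) (u \o row) ->
  bmeas (fun h => u (x + r *: h)) ->
  mean (eucl_ball x r) u = mean D (fun h => u (x + r *: h)).
Proof.
move=> r0 mu /bmeas_integrable bu.
have rn0 : r != 0 by rewrite gt_eqF.
have mB := measurable_eucl_ball x r.
have := @affine_preimage_ball x 0 r 1 r0; rewrite scaler0 addr0 mulr1 => e.
have eF : (u \o row) \o affine_tuple x r = (fun h => u (x + r *: h)) \o row.
  by apply/funext => t /=; rewrite row_affine_tuple.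
rewrite /mean (@Rintegral_affine x r)//; last by rewrite e -compA eF.
rewrite e eF -[in RHS]e lebesgue_measure_tuple_affine// gtr0_norm//.
have fB : leb (row @^-1` eucl_ball x r) \is a fin_num.
  rewrite (_ : leb _ = ((r ^+ n)%:E * leb Dt)%E).
    by rewrite fin_numM// ge0_fin_numE// lebesgue_measure_ball_fin.
  rewrite -e lebesgue_measure_tuple_affine// gtr0_norm// muleA -EFinM.
  by rewrite mulfV ?mul1e// expf_neq0.
by rewrite e fineM//= invfM invrK mulrCA mulrA.
Qed.

Lemma ucont_dot X A : ucont A (dot X).
Proof.
move=> e e0; exists (e / (1 + eucl_norm X)) => [|x y _ _].
  by rewrite divr_gt0// ltr_wpDr ?eucl_norm_ge0.
rewrite ltr_pdivlMr ?ltr_wpDr ?eucl_norm_ge0// => xy.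
apply: le_lt_trans xy; rewrite -dotNr -dotDr ler_norml.
have := dot_le X (x - y); have := dot_ge X (x - y).
have := eucl_norm_ge0 X; have := eucl_norm_ge0 (x - y).
by move=> ? ? ? ?; apply/andP; split; nra.
Qed.

Lemma bmeas_dot X : bmeas (dot X).
Proof.
apply: bmeas_ucont; first exact: ucont_dot.
exists (eucl_norm X) => h; rewrite /eucl_ball/= subr0 => /ltW h1.
have := dot_le X h; have := dot_ge X h; have := eucl_norm_ge0 X.
have := eucl_norm_ge0 h.
by move=> ? ? ? ?; rewrite ler_norml; apply/andP; split; nra.
Qed.

(** The unit ball is symmetric, so odd functions average to zero. *)
Lemma mean_dot X : mean D (dot X) = 0.
Proof.
have mirror : affine_tuple 0 (-1) @^-1` Dt = Dt.
  apply/seteqP; split => t; rewrite /eucl_ball/= row_affine_tuple;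
    by rewrite add0r scaleN1r !subr0 eucl_normN.
have eF : (dot X \o row) \o affine_tuple 0 (-1) = (fun h => -1 * dot X h) \o row.
  by apply/funext => t /=; rewrite row_affine_tuple add0r dotZr.
have ib := bmeas_integrable (bmeasZ (-1) (bmeas_dot X)).
rewrite /mean.
have n10 : (-1 : R) != 0 by rewrite oppr_eq0 oner_eq0.
have := @Rintegral_affine 0 (-1) _ _ n10 mDt (bmeas_dot X).1.
rewrite mirror -compA eF => /(_ ib).
rewrite normrN1 expr1n mul1r => I.
suff -> : Rintegral leb Dt (dot X \o row) = 0 by rewrite mulr0.
have := RintegralZl (-1) mDt (bmeas_integrable (bmeas_dot X)).
rewrite -[LHS]I; lra.
Qed.

End ball_mean.

(** * The averaging functional on the unit ball *)

Section averaging_functional.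
Context {R : realType} {n : nat}.
Variable p : R.
Hypothesis p2 : 2 <= p.
Local Notation D := (eucl_ball (0 : 'rV[R]_n) 1).
Implicit Types (x c h X z : 'rV[R]_n) (F G : 'rV[R]_n -> R).

(** The operator seen from one center, its ball being rescaled to the unit
    ball. *)
Definition tug_avg F : R :=
  (p - 2) / (n%:R + p) *
    (2^-1 * sup [set F h | h in D] + 2^-1 * inf [set F h | h in D]) +
  (n%:R + 2) / (n%:R + p) * mean D F.

(** The coefficient of the mean in [tug_avg]; its positivity is the source of the
    strict monotonicity below. *)
Definition mean_weight : R := (n%:R + 2) / (n%:R + p).

Let np0 : 0 < n%:R + p. Proof. by rewrite ltr_wpDl// (lt_le_trans _ p2). Qed.

Let game_ge0 : 0 <= (p - 2) / (n%:R + p).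
Proof. by rewrite divr_ge0 ?subr_ge0// ltW. Qed.

Lemma mean_weight_gt0 : 0 < mean_weight.
Proof. by rewrite divr_gt0// ltr_wpDl. Qed.

Let game_weightE : (p - 2) / (n%:R + p) = 1 - mean_weight.
Proof. by rewrite /mean_weight; field; rewrite gt_eqF. Qed.

Let D0 : D 0. Proof. exact: eucl_ball_center. Qed.

Lemma bmeas_has_sup F : bmeas F -> has_sup [set F h | h in D].
Proof.
move=> [_ [C FC]]; split; first by exists (F 0), 0.
by exists C => _ [h Dh <-]; apply: le_trans (FC h Dh); exact: ler_norm.
Qed.

Lemma bmeas_has_inf F : bmeas F -> has_inf [set F h | h in D].
Proof.
move=> [_ [C FC]]; split; first by exists (F 0), 0.
exists (- C) => _ [h Dh <-]; rewrite lerNl; apply: le_trans (FC h Dh).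
by rewrite -normrN ler_norm.
Qed.

Lemma le_sup_bmeas F h : bmeas F -> D h -> F h <= sup [set F h | h in D].
Proof. by move=> /bmeas_has_sup[_ ub] Dh; apply: ub_le_sup => //; exists h. Qed.

Lemma ge_inf_bmeas F h : bmeas F -> D h -> inf [set F h | h in D] <= F h.
Proof. by move=> /bmeas_has_inf[_ lb] Dh; apply: ge_inf => //; exists h. Qed.

(** The supremum and the infimum only see the global bound, but the mean sees
    the improved bound on the small ball, in proportion to its measure. *)
Lemma tug_avg_strict F G (M eta : R) c s : bmeas F -> bmeas G ->
    0 < s -> eucl_ball c s `<=` D ->
    (forall h, D h -> F h <= G h + M) ->
    (forall h, eucl_ball c s h -> F h <= G h + M - eta) ->
  tug_avg F <= tug_avg G + M - mean_weight * (eta * s ^+ n).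
Proof.
move=> bF bG s0 sub FG FGs.
have supFG : sup [set F h | h in D] <= sup [set G h | h in D] + M.
  apply: ge_sup; first by exists (F 0), 0.
  by move=> _ [h Dh <-]; apply: le_trans (FG h Dh) _; rewrite lerD2r le_sup_bmeas.
have infFG : inf [set F h | h in D] <= inf [set G h | h in D] + M.
  rewrite -lerBlDr; apply: lb_le_inf; first by exists (G 0), 0.
  move=> _ [h Dh <-]; rewrite lerBlDr; apply: le_trans (FG h Dh).
  exact: ge_inf_bmeas.
have meanFG : mean D F <= mean D G + M - eta * s ^+ n.
  have bI := bmeasZ (- eta) (bmeas_indic c s).
  rewrite -mulNr -(mean_indic_ball s0 sub) -meanZ; last exact: bmeas_indic.
  rewrite -[X in _ + X + _](@mean_cst R n M) -!meanD//; last 2 first.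
  - by apply: bmeasD => //; exact: bmeas_cst.
  - exact: bmeas_cst.
  apply: mean_le => //.
    by apply: bmeasD bI; apply: bmeasD bG _; exact: bmeas_cst.
  move=> h Dh; rewrite indicE; case: (boolP (h \in _)) => [|_].
    by rewrite inE => /FGs; rewrite mulr1.
  by rewrite mulr0 addr0; exact: FG.
rewrite /tug_avg -/mean_weight game_weightE.
have := mean_weight_gt0; have := game_ge0; rewrite game_weightE => ga wgt.
have {}supFG := ler_wpM2l ga supFG; have {}infFG := ler_wpM2l ga infFG.
have {}meanFG := ler_wpM2l (ltW wgt) meanFG.
by lra.
Qed.

Lemma tug_avg_le F G (M : R) : bmeas F -> bmeas G ->
  (forall h, D h -> F h <= G h + M) -> tug_avg F <= tug_avg G + M.
Proof.
move=> bF bG FG.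
have := @tug_avg_strict F G M 0 0 1 bF bG ltr01 (@subset_refl _ D) FG.
rewrite mul0r mulr0 subr0; apply => h Dh; rewrite subr0; exact: FG.
Qed.

Lemma tug_avgN F : bmeas F -> tug_avg (fun h => - F h) = - tug_avg F.
Proof.
move=> bF; rewrite /tug_avg meanN//.
have e : [set - F h | h in D] = -%R @` [set F h | h in D].
  by rewrite image_comp.
have -> : sup [set - F h | h in D] = - inf [set F h | h in D].
  by rewrite /inf opprK e.
have -> : inf [set - F h | h in D] = - sup [set F h | h in D].
  rewrite /inf; congr (- sup _); apply/seteqP; split.
    by move=> _ [_ [h Dh <-] <-]; exists h; rewrite ?opprK.
  by move=> _ [h Dh <-]; exists (- F h); [exists h|rewrite opprK].
by ring.
Qed.

Lemma tug_avgZ_ge F (k : R) : 0 < k -> bmeas F ->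
  k * tug_avg F <= tug_avg (fun h => k * F h).
Proof.
move=> k0 bF; have bkF := bmeasZ k bF.
have supF : k * sup [set F h | h in D] <= sup [set k * F h | h in D].
  rewrite -ler_pdivlMl//; apply: ge_sup; first by exists (F 0), 0.
  by move=> _ [h Dh <-]; rewrite ler_pdivlMl// (le_sup_bmeas bkF).
have infF : k * inf [set F h | h in D] <= inf [set k * F h | h in D].
  apply: lb_le_inf; first by exists (k * F 0), 0.
  by move=> _ [h Dh <-]; rewrite ler_pM2l// ge_inf_bmeas.
rewrite /tug_avg meanZ//.
have {}supF := ler_wpM2l game_ge0 supF; have {}infF := ler_wpM2l game_ge0 infF.
by lra.
Qed.

Lemma tug_avg_cst (k : R) : tug_avg (fun=> k) = k.
Proof.
rewrite /tug_avg mean_cst (_ : [set _ | _ in D] = [set k]); last first.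
  by apply/seteqP; split => [_ [h _ <-]//|_ ->]; exists 0.
by rewrite sup1 inf1 -/mean_weight game_weightE; field.
Qed.

(** * The exponential barrier *)

Definition gauss (m : R) x : R := expR (- (m * eucl_norm x ^+ 2)).

Lemma expR_ge_sqr (s : R) : 0 <= s -> 1 + s + s ^+ 2 / 4 <= expR s.
Proof.
move=> s0; have -> : s = s / 2 + s / 2 by lra.
rewrite expRD; have := expR_ge1Dx (s / 2).
have := expR_gt0 (s / 2); nra.
Qed.

Lemma gauss_shift m X h (r : R) : gauss m (X + r *: h) =
  gauss m X * expR (- (m * (2 * r * dot X h + r ^+ 2 * eucl_norm h ^+ 2))).
Proof.
rewrite /gauss -expRD eucl_normDsqr eucl_normZ exprMn dotZr.
by rewrite real_normK ?num_real//; congr expR; ring.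
Qed.

Lemma gauss_gt0 m X : 0 < gauss m X. Proof. exact: expR_gt0. Qed.

Lemma bmeas_gauss m X (r : R) : 0 <= m -> bmeas (fun h => gauss m (X + r *: h)).
Proof.
move=> m0; split; last first.
  exists 1 => h _; rewrite ger0_norm ?(ltW (gauss_gt0 _ _))// -expR0 ler_expR.
  by rewrite oppr_le0 mulr_ge0// sqr_ge0.
have unorm : ucont D eucl_norm.
  move=> e e0; exists e => // x y _ _ /le_lt_trans; apply.
  have := eucl_dist_triangle y x 0; have := eucl_dist_triangle x y 0.
  rewrite !subr0 (eucl_normB y x) => h1 h2.
  by rewrite ler_norml; apply/andP; split; lra.
have mnorm := measurable_ucont (@eucl_ball_open R n 0 1) unorm.
have [mdot _] := bmeas_dot X.
rewrite (_ : _ \o _ = (fun t => gauss m X * expR (- (m * (2 * r *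
    (dot X \o @row_of_tuple R n) t +
    r ^+ 2 * ((@eucl_norm R n \o @row_of_tuple R n) t) ^+ 2))))); last first.
  by apply/funext => t; rewrite /= gauss_shift.
apply: measurable_funM => //.
apply: (measurableT_comp (@measurable_expR R)).
apply: (measurableT_comp (@oppr_measurable R setT)).
apply: measurable_funM => //; apply: measurable_funD.
  exact: measurable_funM.
by apply: measurable_funM => //; apply: measurable_funX.
Qed.

(** Bounding the exponential below by its tangent line costs [m * r ^+ 2], since
    the linear term averages to zero.  The quadratic term, kept only on a small
    ball on the side of the center of the Gaussian, wins it back. *)
Lemma gauss_mean m X (r : R) : 0 < m -> 0 <= r -> r <= eucl_norm X ->
    16 * 8 ^+ n <= m * eucl_norm X ^+ 2 ->
  gauss m X <= mean D (fun h => gauss m (X + r *: h)).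
Proof.
move=> m0 r0 rX mX; set E := gauss m X; set N := eucl_norm X.
have E0 : 0 < E by exact: gauss_gt0.
have N0 : 0 < N.
  rewrite lt_neqAle eucl_norm_ge0 andbT; apply/eqP => N0.
  move: mX; rewrite -/N -N0 expr0n mulr0 leNgt => /negP; apply.
  by rewrite mulr_gt0// exprn_gt0.
(* On the ball of center [c] and radius 1/8, [dot X] is at most -3/4 N. *)
pose c := - (7 / 8 / N) *: X.
have cN : eucl_norm c = 7 / 8.
  rewrite eucl_normZ normrN gtr0_norm ?divr_gt0// -/N divfK//.
  by rewrite gt_eqF.
have subD : eucl_ball c 8^-1 `<=` D.
  move=> h; rewrite /eucl_ball/= subr0 => hc.
  have -> : h = (h - c) + c by rewrite subrK.
  apply: le_lt_trans (eucl_normD _ _) _; rewrite cN; lra.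
pose G h := E + ((- (2 * m * r * E)) * dot X h +
  (- (m * r ^+ 2 * E) + (m ^+ 2 * N ^+ 2 * r ^+ 2 / 16 * E) * \1_(eucl_ball c 8^-1) h)).
have bI := bmeas_indic c 8^-1.
have bG3 := bmeasD (bmeas_cst (- (m * r ^+ 2 * E)))
  (bmeasZ (m ^+ 2 * N ^+ 2 * r ^+ 2 / 16 * E) bI).
have bG2 := bmeasD (bmeasZ (- (2 * m * r * E)) (bmeas_dot X)) bG3.
have bG := bmeasD (bmeas_cst E) bG2.
have : mean D G <= mean D (fun h => gauss m (X + r *: h)).
  apply: mean_le => //; first exact: bmeas_gauss (ltW m0).
  move=> h Dh; rewrite gauss_shift -/E /G.
  have h1 : eucl_norm h ^+ 2 <= 1.
    by rewrite expr_le1// ?eucl_norm_ge0//; move: Dh; rewrite /eucl_ball/= subr0 => /ltW.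
  have mr0 : 0 <= m * r ^+ 2 by rewrite mulr_ge0 ?sqr_ge0// ltW.
  set q := eucl_norm h ^+ 2 in h1 *.
  rewrite indicE; have [hc|hc] := boolP (h \in eucl_ball c 8^-1); last first.
    rewrite mulr0 addr0; apply: le_trans (ler_wpM2l (ltW E0) (expR_ge1Dx _)).
    by have := ler_wpM2l mr0 h1 => h2; nra.
  move: hc; rewrite inE /eucl_ball/= => hc.
  have Xh : dot X h <= - (3 / 4 * N).
    have -> : h = c + (h - c) by rewrite addrC subrK.
    rewrite dotDr dotZr -eucl_norm_sqr -/N.
    have := dot_le X (h - c); rewrite -/N.
    have -> : - (7 / 8 / N) * N ^+ 2 = - (7 / 8 * N) by field; rewrite gt_eqF.
    by move=> ?; nra.
  set d := dot X h in Xh *.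
  have d1 : m * r * N / 2 <= - (m * (2 * r * d + r ^+ 2 * q)).
    have mr : 0 <= m * r by rewrite mulr_ge0// ltW.
    have e1 := ler_wpM2l mr Xh; have e2 := ler_wpM2l mr rX.
    have e3 := ler_wpM2l mr0 h1; rewrite -/N in e2; nra.
  have d2 : - (2 * m * r * d) - m * r ^+ 2 <= - (m * (2 * r * d + r ^+ 2 * q)).
    by have e3 := ler_wpM2l mr0 h1; nra.
  set s := - _ in d1 d2 *.
  have mrN : 0 <= m * r * N / 2 by rewrite !mulr_ge0// ?ltW.
  have sq : (m * r * N / 2) ^+ 2 <= s ^+ 2.
    by rewrite ler_sqr ?nnegrE ?(le_trans mrN).
  apply: le_trans (ler_wpM2l (ltW E0) (expR_ge_sqr (le_trans mrN d1))).
  rewrite mulr1 -subr_ge0.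
  have -> : E * (1 + s + s ^+ 2 / 4) - (E + (- (2 * m * r * E) * d +
      (- (m * r ^+ 2 * E) + m ^+ 2 * N ^+ 2 * r ^+ 2 / 16 * E))) =
    E * ((s - (- (2 * m * r * d) - m * r ^+ 2)) +
         (s ^+ 2 - (m * r * N / 2) ^+ 2) / 4) by field.
  by rewrite mulr_ge0 ?(ltW E0)// addr_ge0 ?divr_ge0 ?subr_ge0.
apply: le_trans.
rewrite /G !meanD ?mean_cst ?meanZ ?mean_dot//; try exact: bmeas_dot;
  try exact: bmeas_cst; try exact: bmeasZ; try exact: (bmeasZ _ (bmeas_dot X)).
rewrite mean_indic_ball// mulr0 add0r lerDl exprVn.
have p8 : 0 < 8 ^+ n :> R by rewrite exprn_gt0.
have -> : - (m * r ^+ 2 * E) + m ^+ 2 * N ^+ 2 * r ^+ 2 / 16 * E / 8 ^+ n =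
  m * r ^+ 2 * E * (m * N ^+ 2 - 16 * 8 ^+ n) / (16 * 8 ^+ n).
  by field; rewrite gt_eqF.
by rewrite divr_ge0 ?mulr_ge0 ?sqr_ge0 ?subr_ge0// ?ltW.
Qed.

(** The infimum loses and the supremum gains the same amount to first order; the
    quadratic gain of the supremum then prevails. *)
Lemma gauss_midrange m X (r : R) : 0 < m -> 0 < r -> r <= eucl_norm X ->
    48 <= m * eucl_norm X ^+ 2 ->
  gauss m X <= 2^-1 * sup [set gauss m (X + r *: h) | h in D] +
               2^-1 * inf [set gauss m (X + r *: h) | h in D].
Proof.
move=> m0 r0 rX mX; set E := gauss m X; set N := eucl_norm X in rX mX *.
have E0 : 0 < E by exact: gauss_gt0.
have N0 : 0 < N by exact: lt_le_trans rX.
have bG := bmeas_gauss X r (ltW m0).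
have infG : E * (1 - 2 * m * N * r - m * r ^+ 2) <=
    inf [set gauss m (X + r *: h) | h in D].
  apply: lb_le_inf; first by exists (gauss m (X + r *: 0)), 0.
  move=> _ [h Dh <-]; rewrite gauss_shift -/E.
  apply: ler_wpM2l; first exact: ltW.
  apply: le_trans (expR_ge1Dx _).
  have h1 : eucl_norm h <= 1 by move: Dh; rewrite /eucl_ball/= subr0 => /ltW.
  have h2 : eucl_norm h ^+ 2 <= 1 by rewrite expr_le1// eucl_norm_ge0.
  have Xh : dot X h <= N.
    by apply: le_trans (dot_le _ _) _; rewrite -/N ler_piMr// ltW.
  have mr : 0 <= m * r by rewrite mulr_ge0// ltW.
  have mr2 : 0 <= m * r ^+ 2 by rewrite mulr_ge0 ?sqr_ge0// ltW.
  have e1 := ler_wpM2l mr Xh; have e2 := ler_wpM2l mr2 h2.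
  nra.
pose tau : R := 1 - r / (2 * N).
have rN : r / N <= 1 by rewrite ler_pdivrMr// mul1r.
have tau2E : r / (2 * N) = (r / N) / 2 by field; rewrite gt_eqF.
have rN0 : 0 < r / N by rewrite divr_gt0.
(* The ball is open, so that its point nearest to the center of the Gaussian is
   out of reach; with this [tau] the error is of the order of [r ^+ 2]. *)
have tau1 : tau < 1 by rewrite /tau tau2E; lra.
have tau12 : 2^-1 <= tau by rewrite /tau tau2E; lra.
have supG : E * (1 + 2 * m * N * r - 2 * m * r ^+ 2 + m ^+ 2 * r ^+ 2 * N ^+ 2 / 16)
    <= sup [set gauss m (X + r *: h) | h in D].
  pose h0 := - (tau / N) *: X.
  have h0N : eucl_norm h0 = tau.
    rewrite eucl_normZ normrN gtr0_norm ?divr_gt0//; last by lra.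
    by rewrite -/N divfK// gt_eqF.
  have Dh0 : D h0 by rewrite /eucl_ball/= subr0 h0N.
  apply: le_trans (le_sup_bmeas bG Dh0).
  rewrite gauss_shift -/E; apply: ler_wpM2l; first exact: ltW.
  rewrite h0N dotZr -eucl_norm_sqr -/N.
  have -> : - (tau / N) * N ^+ 2 = - (tau * N) by field; rewrite gt_eqF.
  have tN : tau * N = N - r / 2 by rewrite /tau; field; rewrite gt_eqF.
  rewrite mulrN tN.
  set s := (X in expR X).
  have sE : s = m * r * (2 * N - r - r * tau ^+ 2) by rewrite /s; field.
  have t1 : tau ^+ 2 <= tau by rewrite expr2; nra.
  have s1 : m * r * N / 2 <= s.
    have mr : 0 < m * r by rewrite mulr_gt0.
    have : N / 2 <= 2 * N - r - r * tau ^+ 2.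
      have : r * tau ^+ 2 <= N - r / 2.
        rewrite -tN; apply: le_trans (ler_wpM2l (ltW r0) t1) _.
        by rewrite mulrC ler_wpM2l//; lra.
      by lra.
    by move=> /(ler_wpM2l (ltW mr)); rewrite sE; lra.
  have s2 : 2 * m * N * r - 2 * m * r ^+ 2 <= s.
    have mr : 0 <= m * r ^+ 2 by rewrite mulr_ge0 ?sqr_ge0// ltW.
    have t2 : tau ^+ 2 <= 1 by lra.
    have := ler_wpM2l mr t2; rewrite sE; nra.
  have mrN : 0 <= m * r * N / 2 by rewrite !mulr_ge0// ?ltW.
  have sq : (m * r * N / 2) ^+ 2 <= s ^+ 2.
    by rewrite ler_sqr ?nnegrE ?(le_trans mrN).
  apply: le_trans (expR_ge_sqr (le_trans mrN s1)); lra.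
have key : 0 <= E * (m * r ^+ 2) * (m * N ^+ 2 - 48).
  by rewrite !mulr_ge0 ?sqr_ge0 ?subr_ge0// ltW.
lra.
Qed.

(** Far from its center, on the scale of its width, a Gaussian is convex enough
    in the radial direction to be a subsolution for both parts of the operator.
    This holds for balls of any radius that do not contain the center, not only
    for small ones. *)
Lemma gauss_tug_avg m X (r : R) : 0 < m -> 0 <= r -> r <= eucl_norm X ->
    48 * 8 ^+ n <= m * eucl_norm X ^+ 2 ->
  gauss m X <= tug_avg (fun h => gauss m (X + r *: h)).
Proof.
move=> m0; rewrite le_eqVlt => /predU1P[<- _ _|r0 rX mX].
  rewrite (_ : (fun _ => _) = (fun=> gauss m X)) ?tug_avg_cst//.
  by apply/funext => h; rewrite scale0r addr0.
have p8 : 1 <= 8 ^+ n :> R by rewrite exprn_ege1// ler1n.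
have mX16 : 16 * 8 ^+ n <= m * eucl_norm X ^+ 2 by lra.
have mX48 : 48 <= m * eucl_norm X ^+ 2 by lra.
have meanE := gauss_mean m0 (ltW r0) rX mX16.
have midE := gauss_midrange m0 r0 rX mX48.
rewrite /tug_avg -/mean_weight game_weightE.
have := mean_weight_gt0; have := game_ge0; rewrite game_weightE => ga wgt.
have {}meanE := ler_wpM2l (ltW wgt) meanE; have {}midE := ler_wpM2l ga midE.
by lra.
Qed.

End averaging_functional.

(** * Exits through the boundary *)

Section boundary_points.
Context {R : realType} {n : nat}.
Implicit Types (Omega K : set 'rV[R]_n) (x y : 'rV[R]_n).

Lemma dist_to_le (A : set 'rV[R]_n) x y : A y -> dist_to A x <= eucl_norm (x - y).
Proof.
move=> Ay; apply: ge_inf; last by exists y.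
by exists 0 => _ [z _ <-]; exact: eucl_norm_ge0.
Qed.

(** A segment that leaves an open set crosses its boundary, because a segment
    is connected. *)
Lemma exit_point Omega x y : open Omega -> Omega x -> ~ Omega y ->
  exists2 xi, boundary Omega xi & eucl_norm (x - xi) <= eucl_norm (x - y).
Proof.
move=> oO Ox Oy; apply: contrapT => noxi.
pose gam (t : R) : 'rV[R]_n := x + t *: (y - x).
have cgam : continuous gam.
  by move=> t; apply: cvgD; [exact: cvg_cst|apply: cvgZr_tmp; exact: cvg_id].
have seg t : `[0, 1]%classic t -> closure Omega (gam t) -> Omega (gam t).
  rewrite /= in_itv/= => /andP[t0 t1] cl; apply: contrapT => nO; apply: noxi.
  exists (gam t); first by split => //; move=> /interior_subset.
  rewrite /gam opprD addrA subrr sub0r eucl_normN eucl_normZ ger0_norm//.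
  by rewrite eucl_normB ler_piMl ?eucl_norm_ge0.
have i1 : (`[0, 1]%classic : set R) 1 by rewrite /= in_itv/= ler01 lexx.
suff e : `[0, 1]%classic `&` gam @^-1` Omega = `[0, 1]%classic.
  move: i1; rewrite -e => -[_]; rewrite /gam/= scale1r addrC subrK.
  exact: Oy.
apply: (@segment_connected R 0 1).
- by exists 0; rewrite /= in_itv/= lexx ler01 /gam scale0r addr0.
- by exists (gam @^-1` Omega) => //; exact: open_comp.
- exists (gam @^-1` closure Omega).
    by apply: closed_comp => // ; exact: closed_closure.
  apply/seteqP; split => t [t01 Ot]; split => //; first exact: subset_closure.
  exact: seg.
Qed.

Lemma boundaryP Omega x : open Omega -> closure Omega x ->
  Omega x \/ boundary Omega x.
Proof.
move=> oO cx; have [Ox|nOx] := pselect (Omega x); [by left|right].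
by split => // /interior_subset.
Qed.

Lemma boundary_notin Omega x : open Omega -> boundary Omega x -> ~ Omega x.
Proof. by rewrite openE => oO [_ nI] /oO. Qed.

End boundary_points.

(** * The operator on functions that are continuous up to the boundary *)

Section operator.
Context {R : realType} {n : nat}.
Variables (Omega : set 'rV[R]_n) (rho : 'rV[R]_n -> R) (p : R).
Hypothesis p2 : 2 <= p.
Hypothesis oO : open Omega.
Hypothesis cK : compact (closure Omega).
Hypothesis rho_adm : admissible_radius Omega rho.
Hypothesis urho : ucont (closure Omega) rho.
Local Notation K := (closure Omega).
Local Notation D := (eucl_ball (0 : 'rV[R]_n) 1).
Local Notation T := (tug_op Omega rho p).
Implicit Types (x y h : 'rV[R]_n) (u v : 'rV[R]_n -> R).

Lemma radius_ge0 x : K x -> 0 <= rho x.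
Proof. by move=> Kx; have [+ _ _] := rho_adm; exact. Qed.

Lemma radius_boundary x : boundary Omega x -> rho x = 0.
Proof. by move=> bx; have [_ _ h] := rho_adm; apply/(h x bx.1). Qed.

(** This keeps the balls of the operator inside the domain, and the centers of
    the barriers outside of these balls. *)
Lemma radius_le x y : K x -> ~ Omega y -> rho x <= eucl_norm (x - y).
Proof.
move=> Kx nOy; have [Ox|bx] := boundaryP oO Kx; last first.
  by rewrite radius_boundary// eucl_norm_ge0.
have [xi bxi xiy] := exit_point oO Ox nOy.
have [_ /(_ x Ox)/andP[_ h] _] := rho_adm.
by apply: le_trans h _; apply: le_trans xiy; exact: dist_to_le.
Qed.

Lemma tug_ball_closure x h : K x -> D h -> K (x + rho x *: h).
Proof.
move=> Kx; rewrite /eucl_ball/= subr0 => h1.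
have [Ox|bx] := boundaryP oO Kx; last by rewrite radius_boundary// scale0r addr0.
apply: subset_closure; apply: contrapT => /(radius_le Kx).
have [_ /(_ x Ox)/andP[r0 _] _] := rho_adm.
rewrite opprD addrA subrr sub0r eucl_normN eucl_normZ gtr0_norm//.
by rewrite leNgt gtr_pMr// h1.
Qed.

Lemma tug_ball_dist x y h : K x -> K y -> D h ->
  eucl_norm (x + rho x *: h - (y + rho y *: h)) <=
  eucl_norm (x - y) + `|rho x - rho y|.
Proof.
move=> Kx Ky; rewrite /eucl_ball/= subr0 => /ltW h1.
rewrite opprD addrACA -scalerBl; apply: le_trans (eucl_normD _ _) _.
by rewrite lerD2l eucl_normZ ler_piMr.
Qed.

Lemma tug_ball_near (e : R) : 0 < e -> exists2 d : R, 0 < d & forall x y h,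
  K x -> K y -> D h -> eucl_norm (x - y) < d ->
  eucl_norm (x + rho x *: h - (y + rho y *: h)) < e.
Proof.
move=> e0; have e20 : 0 < e / 2 by rewrite divr_gt0.
have [d d0 dr] := urho e20.
exists (Num.min d (e / 2)) => [|x y h Kx Ky Dh]; first by rewrite lt_min d0.
rewrite lt_min => /andP[xyd xye].
apply: le_lt_trans (tug_ball_dist Kx Ky Dh) _.
by rewrite [e]splitr ltrD// dr.
Qed.

Lemma ucont_ball u x : ucont K u -> K x -> ucont D (fun h => u (x + rho x *: h)).
Proof.
move=> uu Kx e e0; have [d d0 du] := uu e e0.
have r1 : 0 < 1 + rho x by rewrite ltr_wpDr ?radius_ge0.
exists (d / (1 + rho x)) => [|h h' Dh Dh']; first by rewrite divr_gt0.
rewrite ltr_pdivlMr// => hh'; apply: du; [exact: tug_ball_closure..|].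
rewrite opprD addrACA subrr add0r -scalerBr eucl_normZ ger0_norm ?radius_ge0//.
by apply: le_lt_trans hh'; rewrite mulrC ler_wpM2l ?eucl_norm_ge0// lerDr.
Qed.

Lemma bmeas_ball u x : ucont K u -> K x -> bmeas (fun h => u (x + rho x *: h)).
Proof.
move=> uu Kx; apply: bmeas_ucont; first exact: ucont_ball.
have [C uC] := ucont_bounded cK uu.
by exists C => h Dh; apply: uC; exact: tug_ball_closure.
Qed.

Lemma eucl_ball_image x (r : R) : 0 < r ->
  eucl_ball x r = [set x + r *: h | h in D].
Proof.
move=> r0; apply/seteqP; split => [y|_ [h + <-]].
  rewrite /eucl_ball/= => yx; exists (r^-1 *: (y - x)).
    by rewrite /= subr0 eucl_normZ gtr0_norm ?invr_gt0// mulrC ltr_pdivrMr// mul1r.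
  by rewrite scalerA mulfV ?gt_eqF// scale1r addrC subrK.
by rewrite /eucl_ball/= subr0 addrC addKr eucl_normZ gtr0_norm// gtr_pMr.
Qed.

Lemma tug_op_outside u x : ~ Omega x -> T u x = u x.
Proof.
move=> nOx; have np0 : 0 < n%:R + p by rewrite ltr_wpDl// (lt_le_trans _ p2).
by rewrite /tug_op /midrange_op /mean_op memNset//; field; rewrite gt_eqF.
Qed.

(** After rescaling, the balls of all centers become the same unit ball, and the
    boundary convention is the case of radius zero. *)
Lemma tug_opE u x : ucont K u -> K x ->
  T u x = tug_avg p (fun h => u (x + rho x *: h)).
Proof.
move=> uu Kx; have [Ox|bx] := boundaryP oO Kx; last first.
  have nOx := boundary_notin oO bx.
  rewrite radius_boundary// (_ : (fun h => _) = (fun=> u x)); last first.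
    by apply/funext => h; rewrite scale0r addr0.
  by rewrite tug_avg_cst// tug_op_outside.
have [_ /(_ x Ox)/andP[r0 _] _] := rho_adm.
rewrite /tug_op /midrange_op /mean_op mem_set// /tug_avg.
have -> : [set u y | y in eucl_ball x (rho x)] =
    [set u (x + rho x *: h) | h in D].
  by rewrite eucl_ball_image// image_comp.
rewrite mean_ball//; last exact: bmeas_ball.
apply: measurable_ucont; first exact: eucl_ball_open.
move=> e e0; have [d d0 du] := uu e e0; exists d => // y z.
by rewrite eucl_ball_image// => -[h Dh <-] [h' Dh' <-]; apply: du; exact: tug_ball_closure.
Qed.

Lemma tug_op_le u v x (M : R) : ucont K u -> ucont K v -> K x ->
  (forall y, K y -> u y <= v y + M) -> T u x <= T v x + M.
Proof.
move=> uu uv Kx uvM; rewrite !tug_opE//; apply: tug_avg_le => //; try exact: bmeas_ball.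
by move=> h Dh; apply: uvM; exact: tug_ball_closure.
Qed.

Lemma ucont_tug_op u : ucont K u -> ucont K (T u).
Proof.
move=> uu e e0; have e20 : 0 < e / 2 by rewrite divr_gt0.
have [d d0 du] := uu _ e20; have [d' d'0 dd'] := tug_ball_near d0.
exists d' => // x y Kx Ky xy; rewrite !tug_opE//.
apply: (@le_lt_trans _ _ (e / 2)); last by rewrite ltr_pdivrMr// ltr_pMr// ltr1n.
have close h : D h -> `|u (x + rho x *: h) - u (y + rho y *: h)| < e / 2.
  by move=> Dh; apply: du; [exact: tug_ball_closure..|exact: dd'].
rewrite ler_distlC; apply/andP; split; [rewrite lerBlDr|];
  apply: tug_avg_le => //; try exact: bmeas_ball; move=> h /close;
  by rewrite ltr_distlC => /andP[? ?]; lra.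
Qed.

Lemma ucont_iter_tug_op u k : ucont K u -> ucont K (iter k T u).
Proof. by move=> uu; elim: k => //= k; exact: ucont_tug_op. Qed.

Lemma iter_tug_op_boundary u k x : boundary Omega x -> iter k T u x = u x.
Proof.
move=> /(boundary_notin oO) nOx; elim: k => //= k <-.
exact: tug_op_outside.
Qed.

Lemma iter_tug_op_bounded u (C : R) k x : ucont K u -> K x ->
  (forall y, K y -> `|u y| <= C) -> `|iter k T u x| <= C.
Proof.
move=> uu + uC; elim: k x => [|k IHk] x Kx /=; first exact: uC.
have uk := ucont_iter_tug_op k uu.
rewrite tug_opE//; rewrite ler_norml; apply/andP; split.
  rewrite -(tug_avg_cst p2 (n := n) (- C)) -[leRHS]addr0.
  apply: tug_avg_le => //; [exact: bmeas_cst|exact: bmeas_ball|].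
  move=> h Dh; rewrite addr0; have := IHk _ (tug_ball_closure Kx Dh).
  by rewrite ler_norml => /andP[].
rewrite -[leRHS](tug_avg_cst p2 (n := n) C) -[leRHS]addr0.
apply: tug_avg_le => //; [exact: bmeas_ball|exact: bmeas_cst|].
move=> h Dh; rewrite addr0; have := IHk _ (tug_ball_closure Kx Dh).
by rewrite ler_norml => /andP[].
Qed.

Lemma tug_op_ext u v x : K x -> ucont K u -> (forall y, K y -> u y = v y) ->
  T u x = T v x.
Proof.
move=> Kx uu uv.
have uv' : ucont K v.
  by move=> e /uu[d d0 du]; exists d => // y z Ky Kz; rewrite -!uv//; exact: du.
by apply/eqP; rewrite eq_le; apply/andP; split; rewrite -[leRHS]addr0;
  apply: tug_op_le => // y Ky; rewrite addr0 uv.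
Qed.

Lemma iter_tug_opN u k x : ucont K u -> K x ->
  iter k T (fun y => - u y) x = - iter k T u x.
Proof.
move=> uu; elim: k x => //= k IHk x Kx.
have uk := ucont_iter_tug_op k uu.
rewrite (@tug_op_ext _ (fun y => - iter k T u y))//; last first.
  exact/ucont_iter_tug_op/ucontN.
rewrite !tug_opE//; last exact: ucontN.
by rewrite tug_avgN//; exact: bmeas_ball.
Qed.

End operator.

(** * Boundary estimates *)

(** What a barrier needs of the cone condition: exterior balls whose radius and
    distance to the boundary point are comparable, with one constant [c] for all
    scales [t]. *)
Definition exterior_corkscrew (R : realType) n (Omega : set 'rV[R]_n) (c r : R) :=
  forall xi t, boundary Omega xi -> 0 < t -> t <= r ->
    exists2 z, eucl_norm (z - xi) = t &
      forall x, closure Omega x -> c * t <= eucl_norm (x - z).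

Section cone_to_corkscrew.
Context {R : realType} {n : nat}.
Implicit Types (Omega : set 'rV[R]_n.+1) (x y : 'rV[R]_n.+1).

Lemma eucl_norm_rotation x (Q : 'M[R]_n.+1) :
  rotation Q -> eucl_norm (x *m Q) = eucl_norm x.
Proof.
move=> [QQ _]; congr Num.sqrt.
have dotE y : \sum_i y 0 i ^+ 2 = (y *m y^T) 0 0.
  by rewrite mxE; apply: eq_bigr => i _; rewrite mxE expr2.
by rewrite !dotE trmx_mul mulmxA -(mulmxA x) QQ mulmx1.
Qed.

Lemma cone_corkscrew Omega : open Omega -> uniform_exterior_cone Omega ->
  exists c r : R, [/\ 0 < c, c <= 1, 0 < r & exterior_corkscrew Omega c r].
Proof.
move=> oO [alpha [r [a0 api r0 hcone]]].
have pi0 : 0 < (pi : R) by exact: pi_gt0.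
have cos0 : 0 < cos alpha.
  by apply: cos_gt0_pihalf; apply/andP; split => //; lra.
have cos1 : cos alpha < 1.
  rewrite lt_neqAle cos_le1 andbT; apply/eqP => c1.
  have : sin alpha ^+ 2 = 0 by have := cos2Dsin2 alpha; rewrite c1; lra.
  move/eqP; rewrite sqrf_eq0 => /eqP sa0.
  have : 0 < sin alpha by apply: sin_gt0_pi; apply/andP; split => //; lra.
  by rewrite sa0 ltxx.
(* With this slope the ball of radius [c * t] around the point of the axis at
   distance [t] from the apex stays in the cone: the worst case is
   [- (1 - c) * t <= - (1 + c) * t * cos alpha]. *)
pose c := (1 - cos alpha) / (1 + cos alpha).
have cE : c * (1 + cos alpha) = 1 - cos alpha by rewrite divfK// gt_eqF//; lra.
have c0 : 0 < c by rewrite divr_gt0//; lra.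
have c1 : c <= 1 by rewrite ler_pdivrMr; lra.
exists c, (r / 2); split => //; first by rewrite divr_gt0.
move=> xi t bxi t0 tr; have [Q rotQ sub] := hcone xi bxi.
have [QQ _] := rotQ.
pose e1 : 'rV[R]_n.+1 := delta_mx 0 0.
have e1N : eucl_norm e1 = 1 by exact: eucl_norm_delta.
pose z0 := - t *: e1.
have z0N : eucl_norm z0 = t by rewrite eucl_normZ normrN gtr0_norm// e1N mulr1.
exists (xi + z0 *m Q).
  by rewrite addrC addKr eucl_norm_rotation.
suff ext x : Omega x -> c * t <= eucl_norm (x - (xi + z0 *m Q)).
  move=> x /closureP_eucl clx; rewrite leNgt; apply/negP => lt.
  have [|y Oy yx] := clx (c * t - eucl_norm (x - (xi + z0 *m Q))).
    by rewrite subr_gt0.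
  have := ext y Oy; rewrite leNgt => /negP; apply.
  apply: le_lt_trans (eucl_dist_triangle x _ _) _.
  by rewrite -ltrBrDr.
move=> Ox; rewrite leNgt; apply/negP => lt.
have rotQT : rotation Q^T.
  split; last by rewrite det_tr; case: rotQ.
  by rewrite trmxK; apply: mulmx1C.
pose d := (x - (xi + z0 *m Q)) *m Q^T.
have dN : eucl_norm d < c * t by rewrite eucl_norm_rotation.
apply: (sub x _) Ox; exists (z0 + d).
  have N1 : eucl_norm (z0 + d) <= t + eucl_norm d.
    by apply: le_trans (eucl_normD _ _) _; rewrite z0N.
  split.
    have d0 : d 0 0 <= eucl_norm d.
      by apply: le_trans (coord_le_eucl_norm _ _); exact: ler_norm.
    have z00 : z0 0 0 = - t by rewrite !mxE !eqxx mulr1.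
    rewrite mxE z00.
    have := ler_wpM2r (ltW cos0) N1; nra.
  by have := eucl_norm_ge0 d; nra.
rewrite mulmxDl /d -mulmxA; have -> : Q^T *m Q = 1%:M by exact: mulmx1C.
by rewrite mulmx1 addrA [in RHS](_ : x = (xi + z0 *m Q) + (x - (xi + z0 *m Q)))//
  addrC subrK.
Qed.

End cone_to_corkscrew.

Section boundary_barrier.
Context {R : realType} {n : nat}.
Variables (Omega : set 'rV[R]_n) (rho : 'rV[R]_n -> R) (p : R).
Hypothesis p2 : 2 <= p.
Hypothesis oO : open Omega.
Hypothesis cK : compact (closure Omega).
Hypothesis rho_adm : admissible_radius Omega rho.
Hypothesis urho : ucont (closure Omega) rho.
Variables (c r : R).
Hypothesis c0 : 0 < c.
Hypothesis c1 : c <= 1.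
Hypothesis r0 : 0 < r.
Hypothesis corkscrew : exterior_corkscrew Omega c r.
Local Notation K := (closure Omega).
Local Notation D := (eucl_ball (0 : 'rV[R]_n) 1).
Local Notation T := (tug_op Omega rho p).
Implicit Types (x y h xi : 'rV[R]_n) (u v : 'rV[R]_n -> R).

(* At scale [t] the barrier is a Gaussian of width [t / sqrt m0] around a point at
   distance [t] from the boundary point.  Its height is adjusted to the distances
   [c * t], where the domain may start, and [2 * t]; [theta] is its relative value
   at distance [3 / 2 * t]. *)
Let m0 : R := 48 * 8 ^+ n / c ^+ 2.
Let height : R := expR (- (m0 * c ^+ 2)) - expR (- (m0 * 4)).
Let theta : R := (expR (- (m0 * c ^+ 2)) - expR (- (m0 * (9 / 4)))) / height.

Let m0_gt0 : 0 < m0.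
Proof. by rewrite divr_gt0 ?mulr_gt0 ?exprn_gt0. Qed.

Let csqr : c ^+ 2 <= 1. Proof. by rewrite expr_le1// ltW. Qed.

Let height_gt0 : 0 < height.
Proof. by rewrite subr_gt0 ltr_expR ltrN2 ltr_pM2l//; have := csqr; lra. Qed.

Let theta_gt0 : 0 < theta.
Proof.
rewrite divr_gt0// subr_gt0 ltr_expR ltrN2 ltr_pM2l//.
by have := csqr; lra.
Qed.

Let theta_lt1 : theta < 1.
Proof.
rewrite ltr_pdivrMr// mul1r ltrD2l ltrN2 ltr_expR ltrN2 ltr_pM2l//; lra.
Qed.

Let gauss_scale t x y (a : R) : 0 < t -> 0 <= a -> a * t <= eucl_norm (y - x) ->
  gauss (m0 / t ^+ 2) (y - x) <= expR (- (m0 * a ^+ 2)).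
Proof.
move=> t0 a0 at_le; rewrite ler_expR lerN2.
have : (a * t) ^+ 2 <= eucl_norm (y - x) ^+ 2.
  by rewrite ler_sqr ?nnegrE ?mulr_ge0 ?eucl_norm_ge0// ltW.
have k0 : 0 <= m0 / t ^+ 2 by rewrite divr_ge0 ?sqr_ge0// ltW.
move=> /(ler_wpM2l k0); apply: le_trans.
by rewrite exprMn le_eqVlt; apply/orP; left; apply/eqP; field; rewrite gt_eqF.
Qed.

(** The barrier is exponential in the distance to the center of an exterior
    ball.  It need not be compared with the iterates on the whole domain: a step
    of the operator from the inner half of the ball stays inside the ball. *)
Lemma barrier_step xi u (L A s : R) : boundary Omega xi -> ucont K u ->
    0 < A -> 0 < s -> s / 6 <= r ->
    (forall y, K y -> eucl_norm (y - xi) < s -> u y <= L) ->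
    (forall k y, K y -> eucl_norm (y - xi) < s -> iter k T u y <= L + A) ->
  forall k y, K y -> eucl_norm (y - xi) < s / 12 -> iter k T u y <= L + theta * A.
Proof.
move=> bxi uu A0 s0 sr uL uA.
(* Points at distance at least [s / 2 = 3 * t] from [xi] are at distance at least
   [2 * t] from [z], and points of the ball of radius [s / 12 = t / 2] at most
   [3 / 2 * t]. *)
pose t := s / 6; have t0 : 0 < t by rewrite divr_gt0.
have [z zxi extz] := corkscrew bxi t0 sr.
have nOz : ~ Omega z.
  move=> /subset_closure/extz; rewrite subrr eucl_norm0 leNgt => /negP; apply.
  by rewrite mulr_gt0.
pose m := m0 / t ^+ 2.
have mpos : 0 < m by rewrite divr_gt0// exprn_gt0.
pose B := A / height; have B0 : 0 < B by rewrite divr_gt0.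
pose k0 := expR (- (m0 * c ^+ 2)).
pose W y := L + B * k0 - B * gauss m (y - z).
have W_outer y : 2 * t <= eucl_norm (y - z) -> L + A <= W y.
  move=> /(gauss_scale t0 (ler0n _ 2)); rewrite -/m => g4.
  have := ler_wpM2l (ltW B0) g4.
  have : B * height = A by rewrite divfK// gt_eqF.
  by rewrite /W /height -/k0 (_ : 2 ^+ 2 = 4 :> R); lra.
have W_ge y : K y -> L <= W y.
  move=> /extz/(gauss_scale t0 (ltW c0)); rewrite -/m -/k0 => gk.
  by have := ler_wpM2l (ltW B0) gk; rewrite /W; lra.
have W_super y : K y -> tug_avg p (fun h => W (y + rho y *: h)) <= W y.
  move=> Ky.
  have eqG h : gauss m (y + rho y *: h - z) = gauss m ((y - z) + rho y *: h).
    by rewrite addrAC.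
  have bG := bmeas_gauss (y - z) (rho y) (ltW mpos).
  have bW : bmeas (fun h => W (y + rho y *: h)).
    rewrite /W; under [X in bmeas X]eq_fun do rewrite eqG.
    by apply: bmeasD; [exact: bmeas_cst|exact/bmeasN/bmeasZ].
  have gG : gauss m (y - z) <= tug_avg p (fun h => gauss m ((y - z) + rho y *: h)).
    apply: gauss_tug_avg => //.
    - exact: (radius_ge0 rho_adm).
    - exact: (radius_le oO rho_adm).
    - have : (c * t) ^+ 2 <= eucl_norm (y - z) ^+ 2.
        have ct0 : 0 <= c * t by rewrite mulr_ge0 ?(ltW c0) ?(ltW t0).
        by rewrite ler_sqr ?nnegrE ?ct0 ?eucl_norm_ge0//; exact: extz.
      move=> /(ler_wpM2l (ltW mpos)); apply: le_trans; rewrite le_eqVlt.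
      by apply/orP; left; apply/eqP; rewrite /m /m0; field; rewrite !gt_eqF.
  have := @tug_avg_le R n p p2 (fun h => W (y + rho y *: h))
    (fun h => - (B * gauss m ((y - z) + rho y *: h))) (L + B * k0) bW
    (bmeasN (bmeasZ B bG)).
  rewrite tug_avgN; last exact: bmeasZ.
  have := tug_avgZ_ge p2 B0 bG => gB.
  move=> le1; apply: le_trans (le1 _) _; first by move=> h _; rewrite /W eqG; lra.
  by have := ler_wpM2l (ltW B0) gG; rewrite /W; lra.
have bound k y : K y -> eucl_norm (y - xi) < s -> iter k T u y <= W y.
  elim: k y => [|k IHk] y Ky ys; first by apply: le_trans (uL y Ky ys) (W_ge y Ky).
  have [inn|out] := ltP (eucl_norm (y - xi)) (s / 2); last first.
    apply: le_trans (uA k.+1 y Ky ys) (W_outer y _).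
    have := eucl_dist_triangle z y xi; rewrite zxi /t; lra.
  have uk := ucont_iter_tug_op p2 oO cK rho_adm urho k uu.
  rewrite /= (tug_opE p2 oO cK rho_adm)//.
  apply: le_trans (W_super y Ky); rewrite -[leRHS]addr0.
  apply: (tug_avg_le p2); first exact: (bmeas_ball oO cK rho_adm).
    rewrite /W; apply: bmeasD; first exact: bmeas_cst.
    apply: bmeasN; apply: bmeasZ.
    under [X in bmeas X]eq_fun do rewrite addrAC.
    exact: bmeas_gauss (ltW mpos).
  move=> h Dh; rewrite addr0; apply: IHk; first exact: (tug_ball_closure oO rho_adm).
  have rxi : rho y <= eucl_norm (y - xi).
    by apply: (radius_le oO rho_adm Ky); exact: boundary_notin.
  have -> : y + rho y *: h - xi = (y - xi) + rho y *: h by rewrite addrAC.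
  apply: le_lt_trans (eucl_normD _ _) _; rewrite eucl_normZ ger0_norm; last first.
    exact: (radius_ge0 rho_adm).
  move: Dh; rewrite /eucl_ball/= subr0 => /ltW h1.
  by have := ler_wpM2l (radius_ge0 rho_adm Ky) h1; lra.
move=> k y Ky ys; apply: le_trans (bound k y Ky _) _; first by lra.
have yz : eucl_norm (y - z) <= 3 / 2 * t.
  have := eucl_dist_triangle xi y z; rewrite (eucl_normB xi) zxi /t; lra.
have g9 : expR (- (m0 * (9 / 4))) <= gauss m (y - z).
  rewrite ler_expR lerN2.
  have : eucl_norm (y - z) ^+ 2 <= (3 / 2 * t) ^+ 2.
    by rewrite ler_sqr ?nnegrE ?mulr_ge0 ?eucl_norm_ge0// ltW.
  move=> /(ler_wpM2l (ltW mpos)) /le_trans; apply; rewrite le_eqVlt.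
  by apply/orP; left; apply/eqP; rewrite /m; field; rewrite gt_eqF.
have -> : theta * A = B * (k0 - expR (- (m0 * (9 / 4)))).
  by rewrite /theta /B -/k0; field; rewrite gt_eqF.
by have := ler_wpM2l (ltW B0) g9; rewrite /W; lra.
Qed.

(** Each passage to a smaller scale shrinks the excess over the boundary value by
    the same factor. *)
Lemma iterates_le_near_boundary xi u (e : R) : boundary Omega xi -> ucont K u ->
  0 < e -> exists2 d : R, 0 < d & forall k y, K y -> eucl_norm (y - xi) < d ->
    iter k T u y <= u xi + e.
Proof.
move=> bxi uu e0; have e20 : 0 < e / 2 by rewrite divr_gt0.
have [C0 uC0] := ucont_bounded cK uu.
have Kxi : K xi by case: bxi.
pose C := `|C0| + 1.
have C0' : 0 < C by rewrite ltr_wpDl.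
have uC y : K y -> `|u y| <= C.
  by move=> /uC0 /le_trans; apply; rewrite /C; have := ler_norm C0; lra.
have [d1 d10 du] := uu _ e20.
pose s := Num.min d1 (6 * r).
have s0 : 0 < s by rewrite lt_min d10 mulr_gt0.
pose L := u xi + e / 2; pose A := 2 * C.
have A0 : 0 < A by rewrite mulr_gt0.
have uL y : K y -> eucl_norm (y - xi) < s -> u y <= L.
  rewrite lt_min => Ky /andP[yd _]; have := du y xi Ky Kxi yd.
  by rewrite ltr_distlC => /andP[+ _]; rewrite /L; lra.
have scales j k y : K y -> eucl_norm (y - xi) < s / 12 ^+ j ->
    iter k T u y <= L + theta ^+ j * A.
  have thA i : 0 < theta ^+ i * A by rewrite mulr_gt0// exprn_gt0.
  elim: j k y => [|j IHj] k y Ky ys.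
    rewrite expr0 mul1r; have := iter_tug_op_bounded p2 oO cK rho_adm urho k uu Ky uC.
    rewrite ler_norml => /andP[_ h]; apply: le_trans h _.
    have := uC xi Kxi; rewrite ler_norml => /andP[h _].
    by rewrite /L /A; lra.
  have p12 i : 0 < 12 ^+ i :> R by rewrite exprn_gt0.
  have sj0 : 0 < s / 12 ^+ j by rewrite divr_gt0.
  have sjs : s / 12 ^+ j <= s.
    by rewrite ler_pdivrMr// ler_peMr ?(ltW s0)// exprn_ege1// ler1n.
  have := @barrier_step xi u L (theta ^+ j * A) (s / 12 ^+ j) bxi uu (thA j) sj0 _ _ IHj k y Ky.
  have sr : s / 12 ^+ j / 6 <= r.
    rewrite ler_pdivrMr// (mulrC r); apply: le_trans sjs _.
    by rewrite /s ge_min lexx orbT.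
  move=> /(_ sr) step; apply: le_trans (step _ _) _.
  - by move=> y' Ky' /lt_le_trans/(_ sjs); exact: uL.
  - by move: ys; rewrite exprS invfM mulrA mulrAC.
  by rewrite lerD2l exprS -mulrA.
have [j jlt] : exists j, theta ^+ j * A < e / 2.
  have th1 : `|theta| < 1 by rewrite ger0_norm// ltW.
  have /cvgrPdist_lt/(_ (e / 2 / A)) := cvg_expr th1.
  rewrite divr_gt0// => /(_ isT)[j _ /(_ j (leqnn j))]/=.
  rewrite sub0r normrN => hj; exists j.
  by rewrite -ltr_pdivlMr//; apply: le_lt_trans hj; exact: ler_norm.
exists (s / 12 ^+ j) => [|k y Ky ys]; first by rewrite divr_gt0// exprn_gt0.
apply: le_trans (scales j k y Ky ys) _; rewrite /L; lra.
Qed.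

Lemma iterates_ge_near_boundary xi u (e : R) : boundary Omega xi -> ucont K u ->
  0 < e -> exists2 d : R, 0 < d & forall k y, K y -> eucl_norm (y - xi) < d ->
    u xi - e <= iter k T u y.
Proof.
move=> bxi uu e0; have [d d0 hd] := iterates_le_near_boundary bxi (ucontN uu) e0.
exists d => // k y Ky yxi; have := hd k y Ky yxi.
rewrite (iter_tug_opN p2 oO cK rho_adm urho)//; lra.
Qed.

End boundary_barrier.

(** * Comparison of iterates *)

Section comparison.
Context {R : realType} {n : nat}.
Variables (Omega : set 'rV[R]_n.+1) (rho : 'rV[R]_n.+1 -> R) (p : R).
Hypothesis p2 : 2 <= p.
Hypothesis oO : open Omega.
Hypothesis cK : compact (closure Omega).
Hypothesis rho_adm : admissible_radius Omega rho.
Hypothesis urho : ucont (closure Omega) rho.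
Local Notation K := (closure Omega).
Local Notation D := (eucl_ball (0 : 'rV[R]_n.+1) 1).
Local Notation T := (tug_op Omega rho p).
Implicit Types (x y h : 'rV[R]_n.+1) (u v f : 'rV[R]_n.+1 -> R).

Let invS (N : nat) : R := N.+1%:R^-1.

Lemma invSn_half N : invS (2 * N).+1 = invS N / 2 :> R.
Proof.
by rewrite /invS (_ : (2 * N).+2 = N.+1 * 2)%N ?natrM ?invfM// mulnS; lia.
Qed.

(** A maximum principle for the limit of the difference.  Let [M0] be the largest
    asymptotic value of the difference at pairs of points that get close to each
    other, and [E] the compact set of the points near which it is approached.  If
    [M0] is positive, then [E] avoids the boundary, by the two boundary estimates.
    If [x] is in [E], then the mean forces the whole ball around [x] into [E];
    this is absurd for the point of [E] that has the largest first coordinate.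
    Comparing values at two nearby points, instead of the same point, makes this
    work without any estimate of the modulus of continuity of the iterates. *)
Lemma iterates_comparison u v f : ucont K u -> ucont K v ->
    (forall xi, boundary Omega xi -> forall e : R, 0 < e -> exists2 d : R, 0 < d &
      forall k y, K y -> eucl_norm (y - xi) < d -> iter k T u y <= f xi + e) ->
    (forall xi, boundary Omega xi -> forall e : R, 0 < e -> exists2 d : R, 0 < d &
      forall k y, K y -> eucl_norm (y - xi) < d -> f xi - e <= iter k T v y) ->
  forall e : R, 0 < e -> exists N, forall j k y y', (N <= j)%N -> (N <= k)%N ->
    K y -> K y' -> eucl_norm (y - y') < invS N ->
    iter j T u y <= iter k T v y' + e.
Proof.
move=> uu uv bu bv e e0.
pose P N (m : R) := forall j k y y', (N <= j)%N -> (N <= k)%N ->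
  K y -> K y' -> eucl_norm (y - y') < invS N ->
  iter j T u y <= iter k T v y' + m.
apply: contrapT => notP.
have inv_le (N N' : nat) : (N <= N')%N -> invS N' <= invS N :> R.
  by move=> NN'; rewrite /invS lef_pV2 ?posrE// ler_nat.
have inv_gt0 (N : nat) : 0 < invS N :> R by rewrite /invS invr_gt0.
have P_le N m m' : P N m -> m <= m' -> P N m'.
  move=> PNm mm' j k y y' Nj Nk Ky Ky' yy'.
  by apply: le_trans (PNm j k y y' Nj Nk Ky Ky' yy') _; rewrite lerD2l.
(* From here on, [M0 = inf S >= e] is the least asymptotic upper bound. *)
pose S := [set m | exists N, P N m].
have S_ge m : S m -> e <= m.
  move=> [N PNm]; rewrite leNgt; apply/negP => me; apply: notP; exists N.
  exact: P_le PNm (ltW me).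
have S0 : S !=set0.
  have [Cu uC] := ucont_bounded cK uu; have [Cv vC] := ucont_bounded cK uv.
  exists (Cu + Cv), 0%N => j k y y' _ _ Ky Ky' _.
  have := iter_tug_op_bounded p2 oO cK rho_adm urho j uu Ky uC.
  have := iter_tug_op_bounded p2 oO cK rho_adm urho k uv Ky' vC.
  by rewrite !ler_norml => /andP[? ?] /andP[? ?]; lra.
have S_inf : has_inf S by split => //; exists e.
pose M0 := inf S.
have M0_gt0 : 0 < M0 by apply: lt_le_trans e0 _; exact: lb_le_inf.
have above eta : 0 < eta -> exists N, P N (M0 + eta).
  move=> /(inf_adherent)/(_ S_inf)[m [N PNm] mlt]; exists N.
  exact: P_le PNm (ltW mlt).
have below N eta : 0 < eta -> ~ P N (M0 - eta).
  move=> eta0 PN; have : M0 <= M0 - eta by apply: ge_inf; [case: S_inf|exists N].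
  lra.
pose E := [set x | K x /\ forall N, exists j k y y', [/\ (N <= j)%N, (N <= k)%N,
  K y /\ K y', eucl_norm (y - x) < invS N /\ eucl_norm (y' - x) < invS N &
  iter k T v y' + (M0 - invS N) < iter j T u y]].
have notE x : K x -> ~ E x -> exists N, forall j k y y', (N <= j)%N -> (N <= k)%N ->
    K y -> K y' -> eucl_norm (y - x) < invS N ->
    eucl_norm (y' - x) < invS N ->
    iter j T u y <= iter k T v y' + (M0 - invS N).
  move=> Kx nEx; apply: contrapT => /forallNP h; apply: nEx; split => // N.
  apply: contrapT => nex; apply: (h N) => j k y y' Nj Nk Ky Ky' yx yx'.
  by rewrite leNgt; apply/negP => lt; apply: nex; exists j, k, y, y'.
have E0 : E !=set0.
  apply: contrapT => nE.
  pose Q m y := forall j k y', (m <= j)%N -> (m <= k)%N -> K y' ->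
    eucl_norm (y - y') < invS m ->
    iter j T u y <= iter k T v y' + (M0 - invS m).
  have [x Kx|N NQ] := @near_compact_eucl _ _ K Q cK.
    have [|N hN] := notE x Kx; first by move=> Ex; apply: nE; exists x.
    exists (invS N / 2); first by rewrite divr_gt0.
    exists (2 * N).+1 => y m Ky Nm yx j k y' mj mk Ky' yy'.
    have m_half := inv_le _ _ Nm; rewrite invSn_half in m_half.
    apply: le_trans (hN j k y y' _ _ Ky Ky' _ _) _; [lia|lia| | |].
    - by have := inv_gt0 N; lra.
    - have := eucl_dist_triangle y y' x; rewrite (eucl_normB y' y); lra.
    - by have := inv_gt0 N; lra.
  apply: (below N (invS N) (inv_gt0 N)) => j k y y' Nj Nk Ky Ky' yy'.
  exact: (NQ N y).
have cE : compact E.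
  apply: (subclosed_compact _ cK) => [x /closureP_eucl clx|x []//].
  have Kx : K x.
    rewrite (closure_id K).1; last exact: closed_closure.
    by apply/closureP_eucl => d /clx[y [Ky _] yx]; exists y.
  split => // N; have N20 : 0 < invS N / 2 :> R by rewrite divr_gt0.
  have [x' [_ Ex'] x'x] := clx _ N20.
  have [j [k [y [y' [Nj Nk [Ky Ky']]]]]] := Ex' (2 * N).+1.
  rewrite invSn_half => -[yx' y'x'] lt.
  exists j, k, y, y'; split => //; [lia|lia| |].
    have := eucl_dist_triangle x' y x; have := eucl_dist_triangle x' y' x.
    by move=> ? ?; split; lra.
  by have := inv_gt0 N; lra.
have [x Ex xmax] : exists2 x, x \in E & forall y, y \in E -> y 0 0 <= x 0 0.
  by apply: EVT_max_rV => //; apply: continuous_subspaceT; exact: coord_continuous.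
move: Ex; rewrite inE => -[Kx Ex].
have Ox : Omega x.
  have [//|bx] := boundaryP oO Kx; exfalso.
  have M3 : 0 < M0 / 3 by rewrite divr_gt0.
  have [d d0 hd] := bu x bx _ M3; have [d' d'0 hd'] := bv x bx _ M3.
  have [|N hN] := @invSn_lt R (Num.min (M0 / 3) (Num.min d d')).
    by rewrite !lt_min M3 d0.
  have := hN N (leqnn N); rewrite -/(invS N) !lt_min => /and3P[NM Nd Nd'].
  have [j [k [y [y' [_ _ [Ky Ky'] [yx y'x] lt]]]]] := Ex N.
  have := hd j y Ky (lt_trans yx Nd); have := hd' k y' Ky' (lt_trans y'x Nd').
  by lra.
have rx0 : 0 < rho x by have [_ /(_ x Ox)/andP[]] := rho_adm.
pose e1 : 'rV[R]_n.+1 := delta_mx 0 0.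
have e1N : eucl_norm e1 = 1 by exact: eucl_norm_delta.
(* [q] lies in the ball around [x], but further in the first direction. *)
pose h0 := 2^-1 *: e1.
have h0N : eucl_norm h0 = 2^-1 by rewrite eucl_normZ e1N mulr1 ger0_norm.
have Dh0 : D h0 by rewrite /eucl_ball/= subr0 h0N invf_lt1// ltr1n.
pose q := x + rho x *: h0.
have Kq : K q by exact: (tug_ball_closure oO rho_adm).
have nEq : ~ E q.
  move=> Eq; have := xmax q; rewrite inE => /(_ Eq).
  by rewrite /q !mxE !eqxx mulr1 leNgt ltrDl divr_gt0.
have [N1 hN1] := notE q Kq nEq.
set d1 : R := invS N1 in hN1; have d10 : 0 < d1 by exact: inv_gt0.
pose s := Num.min 2^-1 (d1 / 2 / rho x).
have s0 : 0 < s by rewrite lt_min invr_gt0 ltr0n/= !divr_gt0.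
have s_half : s <= 2^-1 by rewrite ge_min lexx.
have s_rho : rho x * s <= d1 / 2.
  by rewrite mulrC -ler_pdivlMr// ge_min lexx orbT.
have subD : eucl_ball h0 s `<=` D.
  move=> h; rewrite /eucl_ball/= subr0 => hs.
  have -> : h = (h - h0) + h0 by rewrite subrK.
  by apply: le_lt_trans (eucl_normD _ _) _; rewrite h0N; lra.
pose kappa := @mean_weight R n.+1 p * s ^+ n.+1.
have kappa0 : 0 < kappa by rewrite mulr_gt0 ?mean_weight_gt0// exprn_gt0.
(* Half of the gain that the mean makes from the ball around [q]. *)
pose eta := kappa * d1 / 2.
have eta0 : 0 < eta by rewrite divr_gt0// mulr_gt0.
have [N2 hN2] := above _ eta0.
have d1half : 0 < d1 / 2 by rewrite divr_gt0.
have [dx dx0 hdx] := tug_ball_near urho d1half.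
have [dy dy0 hdy] := tug_ball_near urho (inv_gt0 N2).
have [|N3 hN3] := @invSn_lt R (Num.min eta (Num.min dx (dy / 2))).
  by rewrite !lt_min eta0 dx0 divr_gt0.
pose N := maxn N3 (maxn N1 N2).
have := hN3 N.+1; rewrite -/(invS N.+1) !lt_min => /(_ _)/and3P[|Neta Ndx Ndy].
  by apply: leqW; rewrite leq_maxl.
have [[|j] [[|k] [y [y' [//= Nj Nk [Ky Ky'] [yx y'x] lt]]]]] := Ex N.+1.
move: lt; apply/negP; rewrite -leNgt.
have uj := ucont_iter_tug_op p2 oO cK rho_adm urho j uu.
have vk := ucont_iter_tug_op p2 oO cK rho_adm urho k uv.
rewrite !(tug_opE p2 oO cK rho_adm)//.
have bj := bmeas_ball oO cK rho_adm uj Ky.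
have bk := bmeas_ball oO cK rho_adm vk Ky'.
have yy' : eucl_norm (y - y') < dy.
  have := eucl_dist_triangle x y y'; rewrite (eucl_normB x); lra.
have N1N : (N1 <= N)%N := leq_trans (leq_maxl N1 N2) (leq_maxr N3 _).
have N2N : (N2 <= N)%N := leq_trans (leq_maxr N1 N2) (leq_maxr N3 _).
have near_q z h : K z -> eucl_norm (z - x) < dx -> eucl_ball h0 s h ->
    eucl_norm (z + rho z *: h - q) < d1.
  move=> Kz zx hs.
  apply: le_lt_trans (eucl_dist_triangle (x + rho x *: h) _ _) _.
  have -> : x + rho x *: h - q = rho x *: (h - h0).
    by rewrite /q opprD addrACA subrr add0r -scalerBr.
  rewrite eucl_normZ gtr0_norm//.
  have := hdx z x h Kz Kx (subD _ hs) zx.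
  have : rho x * eucl_norm (h - h0) <= rho x * s.
    by rewrite ler_pM2l// ltW.
  by lra.
have := @tug_avg_strict R n.+1 p p2 _ _ (M0 + eta) (eta + d1) h0 s bj bk s0 subD.
move=> /(_ _ _) h; apply: le_trans (h _ _) _.
- move=> z Dz; apply: hN2; [exact: leq_trans N2N Nj|exact: leq_trans N2N Nk| | |].
  + exact: (tug_ball_closure oO rho_adm).
  + exact: (tug_ball_closure oO rho_adm).
  + exact: hdy.
- move=> z hz; have Dz := subD _ hz.
  rewrite -addrA (_ : M0 + eta - (eta + d1) = M0 - d1); last by ring.
  apply: hN1; [exact: leq_trans N1N Nj|exact: leq_trans N1N Nk| | | |].
  + exact: (tug_ball_closure oO rho_adm).
  + exact: (tug_ball_closure oO rho_adm).
  + by apply: near_q => //; exact: lt_trans yx _.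
  + by apply: near_q => //; exact: lt_trans y'x _.
- have : @mean_weight R n.+1 p * ((eta + d1) * s ^+ n.+1) = kappa * eta + 2 * eta.
    by rewrite /eta /kappa; field.
  have : 0 < kappa * eta by rewrite mulr_gt0.
  by lra.
Qed.

End comparison.

(** * The Dirichlet problem *)

Lemma bounded_closure_compact (R : realType) n (A : set 'rV[R]_n) :
  bounded_set A -> compact (closure A).
Proof.
move=> bA; apply: bounded_closed_compact; last exact: closed_closure.
case: bA => M [Mreal MA]; exists (M + 1); split; first exact: num_real.
move=> c Mc x clx; have [y Ay yx] := (closureP_eucl A x).1 clx 1 ltr01.
have M1 : M < c - 1 by lra.
have := MA _ M1 y Ay => /= yc; have -> : x = y - (y - x) by rewrite opprB addrC subrK.
apply: le_trans (ler_normB _ _) _.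
have := le_lt_trans (norm_le_eucl_norm _) yx; lra.
Qed.

Lemma uniform_cvg_eps (R : realType) n (A : set 'rV[R]_n)
    (g : nat -> 'rV[R]_n -> R) (l : 'rV[R]_n -> R) :
  (forall e : R, 0 < e -> exists N, forall k x, (N <= k)%N -> A x ->
     `|l x - g k x| < e) -> {uniform A, g @ \oo --> l}.
Proof.
move=> h P /uniform_nbhs[V [/= entV VP]].
move: entV; rewrite -entourage_ballE => -[e /= e0 eV].
have [N hN] := h e e0; exists N => // k /= Nk; apply: VP => x Ax; apply: eV.
by rewrite /=/ball/=; exact: hN.
Qed.

Lemma continuous_extension (R : realType) n (A : set 'rV[R]_n)
    (f : 'rV[R]_n -> R) : compact A -> {within A, continuous f} ->
  exists2 g : 'rV[R]_n -> R, continuous g & forall x, A x -> g x = f x.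
Proof.
move=> cA cf; have [C fC] := ucont_bounded cA (within_ucont cA cf).
have C0 : 0 < `|C| + 1 by rewrite ltr_wpDl.
have clA : closed A by apply: compact_closed => //; exact: norm_hausdorff.
have nX : normal_space 'rV[R]_n by exact: pseudometric_normal.
have [|g [fg cg _]] := @continuous_bounded_extension _ R nX A clA f (`|C| + 1) C0 cf.
  move=> x /fC /le_trans; apply; have := ler_norm C; lra.
by exists g => // x Ax; rewrite fg// inE.
Qed.

Section dirichlet.
Context {R : realType} {n : nat}.
Variables (Omega : set 'rV[R]_n.+1) (rho : 'rV[R]_n.+1 -> R) (p : R).
Hypothesis p2 : 2 <= p.
Hypothesis oO : open Omega.
Hypothesis cK : compact (closure Omega).
Hypothesis coneO : uniform_exterior_cone Omega.
Hypothesis rho_adm : admissible_radius Omega rho.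
Hypothesis urho : ucont (closure Omega) rho.
Local Notation K := (closure Omega).
Local Notation T := (tug_op Omega rho p).
Implicit Types (x y : 'rV[R]_n.+1) (f u v : 'rV[R]_n.+1 -> R).

Lemma iterates_close u v : ucont K u -> ucont K v ->
    (forall xi, boundary Omega xi -> u xi = v xi) ->
  forall e : R, 0 < e -> exists N, forall j k y y', (N <= j)%N -> (N <= k)%N ->
    K y -> K y' -> eucl_norm (y - y') < N.+1%:R^-1 ->
    iter j T u y <= iter k T v y' + e.
Proof.
move=> uu uv uvb; have [c [r [c0 c1 r0 cork]]] := cone_corkscrew oO coneO.
apply: (iterates_comparison p2 oO cK rho_adm urho uu uv (f := u)) => xi bxi e e0.
  exact: (iterates_le_near_boundary p2 oO cK rho_adm urho c0 c1 r0 cork).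
rewrite uvb//.
exact: (iterates_ge_near_boundary p2 oO cK rho_adm urho c0 c1 r0 cork).
Qed.

Lemma iter_fixed u k : (forall x, Omega x -> T u x = u x) -> iter k T u = u.
Proof.
move=> fixu; have Tu : T u = u.
  apply/funext => x; have [/fixu//|nOx] := pselect (Omega x).
  exact: tug_op_outside.
by elim: k => //= k ->.
Qed.

(** A fixed point is its own sequence of iterates. *)
Lemma iterates_to_fixed u v : ucont K u -> ucont K v ->
    (forall xi, boundary Omega xi -> u xi = v xi) ->
    (forall x, Omega x -> T v x = v x) ->
  forall e : R, 0 < e -> exists N, forall k x, (N <= k)%N -> K x ->
    `|v x - iter k T u x| < e.
Proof.
move=> uu uv uvb fixv e e0; have e20 : 0 < e / 2 by rewrite divr_gt0.
have [N1 h1] := iterates_close uu uv uvb e20.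
have [N2 h2] := iterates_close uv uu (fun xi bxi => esym (uvb xi bxi)) e20.
exists (maxn N1 N2) => k x; rewrite geq_max => /andP[N1k N2k] Kx.
have xx N : eucl_norm (x - x) < N.+1%:R^-1.
  by rewrite subrr eucl_norm0 invr_gt0.
have := h1 k k x x N1k N1k Kx Kx (xx N1).
have := h2 k k x x N2k N2k Kx Kx (xx N2).
rewrite (iter_fixed k fixv) ltr_distlC => ? ?; apply/andP; split; lra.
Qed.

Lemma fixed_unique u v : ucont K u -> ucont K v ->
    (forall xi, boundary Omega xi -> u xi = v xi) ->
    (forall x, Omega x -> T u x = u x) -> (forall x, Omega x -> T v x = v x) ->
  forall x, K x -> u x = v x.
Proof.
move=> uu uv uvb fixu fixv x Kx; apply/eqP; rewrite -subr_eq0 -normr_eq0.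
rewrite eq_le normr_ge0 andbT; apply/ler_addgt0Pr => e e0; rewrite add0r ltW//.
have [N hN] := iterates_to_fixed uu uv uvb fixv e0.
by have := hN N x (leqnn N) Kx; rewrite iter_fixed// distrC.
Qed.

(** The iterates form a uniform Cauchy sequence, as they are close to themselves
    with different indices; the operator is nonexpansive, so that the limit is a
    fixed point. *)
Lemma fixed_exists u : ucont K u -> exists v, [/\ ucont K v,
  forall x, Omega x -> T v x = v x & forall xi, boundary Omega xi -> v xi = u xi].
Proof.
move=> uu; pose v x := limn (fun k => iter k T u x).
have close := iterates_close uu uu (fun _ _ => erefl).
have xx x N : eucl_norm (x - x) < N.+1%:R^-1 :> R.
  by rewrite subrr eucl_norm0 invr_gt0.
have cv x : K x -> (fun k => iter k T u x) @ \oo --> v x.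
  move=> Kx; apply/cauchy_cvgP/cauchy_exP => e e0.
  have [N hN] := close (e / 2) (divr_gt0 e0 (ltr0n _ 2)).
  exists (iter N T u x); exists N => // k /= Nk; rewrite /ball/=.
  have := hN N k x x (leqnn N) Nk Kx Kx (xx x N).
  have := hN k N x x Nk (leqnn N) Kx Kx (xx x N).
  by rewrite ltr_distlC => ? ?; apply/andP; split; lra.
have ucv e : 0 < e -> exists N, forall k x, (N <= k)%N -> K x ->
    `|v x - iter k T u x| <= e.
  move=> e0; have e20 : 0 < e / 2 by rewrite divr_gt0.
  have [N hN] := close _ e20; exists N => k x Nk Kx.
  have /cvgrPdist_lt/(_ _ e20)[M _ hM] := cv x Kx.
  pose j := maxn M N; have Nj : (N <= j)%N := leq_maxr M N.
  have := hM j (leq_maxl M N); rewrite /= => vj.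
  have := hN j k x x Nj Nk Kx Kx (xx x N).
  have := hN k j x x Nk Nj Kx Kx (xx x N).
  move: vj; rewrite ltr_distlC => /andP[? ?] ? ?.
  by rewrite ler_distlC; apply/andP; split; lra.
have uv : ucont K v.
  move=> e e0; have e30 : 0 < e / 3 by rewrite divr_gt0.
  have [N hN] := ucv _ e30.
  have [d d0 hd] := ucont_iter_tug_op p2 oO cK rho_adm urho N uu e30.
  exists d => // x y Kx Ky xy; have := hd x y Kx Ky xy.
  have := hN N x (leqnn N) Kx; have := hN N y (leqnn N) Ky.
  rewrite !ler_distlC !ltr_distlC => /andP[? ?] /andP[? ?] /andP[? ?].
  by apply/andP; split; lra.
exists v; split => //.
  move=> x Ox; have Kx := subset_closure Ox.
  apply/eqP; rewrite -subr_eq0 -normr_eq0 eq_le normr_ge0 andbT.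
  apply/ler_addgt0Pr => e e0; rewrite add0r.
  have e20 : 0 < e / 2 by rewrite divr_gt0.
  have [N hN] := ucv _ e20.
  have uN := ucont_iter_tug_op p2 oO cK rho_adm urho N uu.
  have le1 : T v x <= T (iter N T u) x + e / 2.
    apply: (tug_op_le p2 oO cK rho_adm) => // y Ky.
    by have := hN N y (leqnn N) Ky; rewrite ler_distlC => /andP[? ?]; lra.
  have le2 : T (iter N T u) x <= T v x + e / 2.
    apply: (tug_op_le p2 oO cK rho_adm) => // y Ky.
    by have := hN N y (leqnn N) Ky; rewrite ler_distlC => /andP[? ?]; lra.
  have := hN N.+1 x (leqnSn N) Kx; rewrite /= !ler_distlC => /andP[? ?].
  by apply/andP; split; lra.
move=> xi bxi; apply/eqP; rewrite -subr_eq0 -normr_eq0 eq_le normr_ge0 andbT.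
apply/ler_addgt0Pr => e e0; rewrite add0r.
have [N hN] := ucv _ e0; have := hN N xi (leqnn N) bxi.1.
by rewrite (iter_tug_op_boundary rho p2 oO).
Qed.

End dirichlet.

Unset Implicit Arguments.

Theorem theorem1 (R : realType) (n : nat) (Omega : set 'rV[R]_n.+1)
    (p beta lambda Lambda : R) (rho : 'rV[R]_n.+1 -> R)
    (Omega_domain : domain Omega)
    (Omega_bounded : bounded_set Omega)
    (Omega_cone : uniform_exterior_cone Omega)
    (p_ge2 : 2 <= p)
    (rho_continuous : {within closure Omega, continuous rho})
    (rho_admissible : admissible_radius Omega rho)
    (rho_bounds : forall x, Omega x ->
      lambda * dist_to (boundary Omega) x `^ beta <= rho x /\
      rho x <= Lambda * dist_to (boundary Omega) x)
    (beta_ge1 : 1 <= beta)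
    (Lambda_gt0 : 0 < Lambda)
    (Lambda_lt : Lambda < 1 - ((p - 2) / (n.+1%:R + p)) `^ (1 / beta))
    (lambda_gt0 : 0 < lambda)
    (lambda_le : lambda <= Lambda * (diam Omega / 2) `^ (1 - beta))
    (f : 'rV[R]_n.+1 -> R)
    (f_continuous : {within boundary Omega, continuous f}) :
  exists u_rho : 'rV[R]_n.+1 -> R,
    [/\ dirichlet_solution Omega rho p f u_rho,
        (forall v, dirichlet_solution Omega rho p f v ->
           forall x, closure Omega x -> v x = u_rho x) &
        (forall u, norm_preserving_extension Omega f u ->
           {uniform closure Omega,
              (fun k => iter k (tug_op Omega rho p) u) @ \oo --> u_rho})].
Proof.
have [oO _ _] := Omega_domain.
have cK := bounded_closure_compact Omega_bounded.
have urho := within_ucont cK rho_continuous.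
have bK : boundary Omega `<=` closure Omega by move=> x [].
have cb : compact (boundary Omega).
  apply: (subclosed_compact _ cK bK); rewrite /boundary setDE.
  by apply: closedI; [exact: closed_closure|exact/open_closedC/open_interior].
have [u0 cu0 u0f] := continuous_extension cb f_continuous.
have uu0 : ucont (closure Omega) u0.
  by apply: within_ucont => //; exact: continuous_subspaceT.
have [w [uw fixw wu0]] :=
  fixed_exists p_ge2 oO cK Omega_cone rho_admissible urho uu0.
have wf x : boundary Omega x -> w x = f x.
  by move=> bx; rewrite wu0// u0f.
exists w; split.
- by split => //; exact: ucont_within.
- move=> v [cv fixv vf]; have uv := within_ucont cK cv.
  apply: (fixed_unique p_ge2 oO cK Omega_cone rho_admissible urho) => // x bx.
  by rewrite vf// wf.
- move=> u [cu uf _]; have uu := within_ucont cK cu.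
  apply: uniform_cvg_eps => e e0.
  apply: (iterates_to_fixed p_ge2 oO cK Omega_cone rho_admissible urho) => // x bx.
  by rewrite uf// wf.
Qed.
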